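(* Let $0<T<1$ be fixed, and for $\alpha\ge 0$ let $\hat{\alpha}_{MLE}$ be the maximum likelihood estimator of $\alpha$ based on the observation of the $\alpha$-Brownian bridge $X^{(\alpha)}$ up to time $T$. Then the bias $\mathrm{E}_\alpha[\hat{\alpha}_{MLE}]-\alpha$ satisfies $$\mathrm{E}_\alpha[\hat{\alpha}_{MLE}]-\alpha\sim-\frac{2}{\ln(1-T)},$$ where $f(\alpha)\sim g(\alpha)$ means $\lim_{\alpha\to\infty}[f(\alpha)-g(\alpha)]=0$; that is, $$\lim_{\alpha\to\infty}\left(\mathrm{E}_\alpha[\hat{\alpha}_{MLE}]-\alpha\right)=-\frac{2}{\ln(1-T)}.$$
   Context: Let $W=(W_t)_{t\in[0,1]}$ be a standard Brownian motion. For $\alpha\ge 0$, the $\alpha$-Brownian bridge $X^{(\alpha)}=(X^{(\alpha)}_t)_{t\in[0,1)}$ is the solution of the stochastic differential equation $dX^{(\alpha)}_t=dW_t-\frac{\alpha}{1-t}X^{(\alpha)}_t\,dt$, $X^{(\alpha)}_0=0$, $t\in[0,1)$; explicitly $X^{(\alpha)}_t=\int_0^t\left(\frac{1-t}{1-s}\right)^{\alpha}dW_s$. The maximum likelihood estimator of $\alpha$ based on a trajectory observed until time $T<1$ is $$\hat{\alpha}_{MLE}=-\left(\int_0^T\frac{X^{(\alpha)}_s}{1-s}\,dX^{(\alpha)}_s\right)\Big/\left(\int_0^T\frac{(X^{(\alpha)}_s)^2}{(1-s)^2}\,ds\right),$$ which can equivalently be written as $$\hat{\alpha}_{MLE}=\left(-\frac{(X^{(\alpha)}_T)^2}{1-T}+\int_0^T\frac{(X^{(\alpha)}_s)^2}{(1-s)^2}\,ds-\ln(1-T)\right)\Big/\left(2\int_0^T\frac{(X^{(\alpha)}_s)^2}{(1-s)^2}\,ds\right).$$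 $\mathrm{E}_\alpha$ denotes expectation when the true parameter is $\alpha$. *)

(* Defs.v *)
From HB Require Import structures.
From mathcomp Require Export all_boot all_order all_algebra.
From mathcomp Require Export all_classical all_reals all_analysis.

Set Implicit Arguments.
Unset Strict Implicit.
Unset Printing Implicit Defensive.

Export Order.TTheory GRing.Theory Num.Theory.
Export numFieldNormedType.Exports.

Local Open Scope classical_set_scope.
Local Open Scope ring_scope.

Section stochastic_processes.
Context {d : measure_display} {Omega : measurableType d} {R : realType}.
Variable P : probability Omega R.

(* Choosing [B i = setT] for some of the indices yields the product rule for
   every subfamily. *)
Definition mutually_independent (n : nat) (Y : 'I_n -> Omega -> R) : Prop :=
  forall B : 'I_n -> set R, (forall i, measurable (B i)) ->
    P [set w | forall i, B i (Y i w)] = (\prod_(i < n) P (Y i @^-1` B i))%E.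

(* Standard Brownian motion on [0, 1]; the values [W t] for [t] outside [0, 1]
   are irrelevant.  The second parameter of [normal_prob] is the standard
   deviation. *)
Definition brownian_motion (W : R -> {RV P >-> R}) : Prop :=
  [/\ {ae P, forall w, W 0 w = 0},
      (forall s t : R, 0 <= s -> s < t -> t <= 1 ->
         forall B : set R, measurable B ->
           P ((fun w => W t w - W s w) @^-1` B) =
           normal_prob 0 (Num.sqrt (t - s)) B),
      (forall (n : nat) (t : nat -> R),
         0 <= t 0%N -> (forall i, (i < n)%N -> t i <= t i.+1) -> t n <= 1 ->
         mutually_independent (fun (i : 'I_n) w => W (t i.+1) w - W (t i) w)) &
      {ae P, forall w, {within `[0, 1], continuous (fun t => W t w)}}].

(* The noise in dX = dW - alpha / (1 - t) X dt is additive, so the equation in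
   integral form involves only a pathwise Lebesgue integral.  A single
   negligible set serves all times. *)
Definition alpha_brownian_bridge (W : R -> {RV P >-> R}) (alpha : R)
    (X : R -> {RV P >-> R}) : Prop :=
  {ae P, forall w,
    [/\ X 0 w = 0,
        {within `[0, 1[, continuous (fun t => X t w)} &
        forall t, 0 <= t < 1 ->
          X t w = W t w
            - \int[lebesgue_measure]_(s in `[0, t]) (alpha / (1 - s) * X s w)]}.

(* Left-endpoint sum of H against X along the partition [a :: s], whose last
   point is [b] when [itv_partition a b s] holds. *)
Definition left_sum (a b : R) (H X : R -> Omega -> R) (s : seq R) (w : Omega)
    : R :=
  let t := nth b (a :: s) in
  \sum_(i < size s) H (t i) w * (X (t i.+1) w - X (t i) w).

Definition mesh_lt (a b : R) (s : seq R) (delta : R) : Prop :=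
  let t := nth b (a :: s) in
  forall i, (i < size s)%N -> t i.+1 - t i < delta.

(* Ito integral of a continuous adapted integrand H against a continuous
   semimartingale X over [a, b]: the limit in probability of the left-endpoint
   sums as the mesh of the partition tends to 0.  The limit is unique up to
   almost sure equality. *)
Definition is_ito_integral (a b : R) (H X : R -> Omega -> R)
    (I : {RV P >-> R}) : Prop :=
  forall eps eta : R, 0 < eps -> 0 < eta ->
    exists2 delta : R, 0 < delta &
      forall s : seq R, itv_partition a b s -> mesh_lt a b s delta ->
        (P [set w | (eps <= `|left_sum a b H X s w - I w|)%R] <= eta%:E)%E.

(* The maximum likelihood estimator of alpha from a trajectory of X on [0, T];
   as the Ito integral in its numerator, it is determined up to almost sure
   equality. *)
Definition is_alpha_mle (T : R) (X : R -> {RV P >-> R})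
    (alphahat : {RV P >-> R}) : Prop :=
  exists2 I : {RV P >-> R},
    is_ito_integral 0 T (fun s w => X s w / (1 - s)) (fun s w => X s w) I &
    {ae P, forall w, alphahat w =
      - I w / \int[lebesgue_measure]_(s in `[0, T]) (X s w ^+ 2 / (1 - s) ^+ 2)}.

End stochastic_processes.

(* Main.v *)
Require Import Defs.
From HB Require Import structures.
From mathcomp Require Import ring lra measurable_realfun.

Set Implicit Arguments.
Unset Strict Implicit.
Unset Printing Implicit Defensive.

Local Open Scope classical_set_scope.
Local Open Scope ring_scope.

(** In the clock u = - ln (1 - t), which runs over [0, L] with
    L = - ln (1 - T), the process Y_u = X_t / sqrt (1 - t) is an
    Ornstein-Uhlenbeck process dY = dB - theta Y du with
    theta = alpha - 1/2.  Let S = int_0^L Y^2 du ([energy]) and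
    Q = Y_L^2 ([terminal]).  The Ito integral in the estimator is
    (Q - S - L) / 2, so the estimator is 1/2 + (L - Q) / (2 S) and its bias is
    (L / 2) E[1 / S] - E[Q / S] / 2 - theta.  For large theta,
    (L / 2) E[1 / S] = theta + 5 / (2 L) + o(1) and E[Q / S] = 1 / L + o(1),
    whence the limit 2 / L.  [mle_bias_bound] makes this quantitative: the bias
    differs from 2 / L by at most 4 / (L^2 theta).

    The joint Laplace transform of (S, Q) is explicit ([bridge_laplace]).  On
    the grid t_i = 1 - exp (- i L / n), which is equidistant in u, the bridge is
    close to the Gaussian recursion X_(i+1) = exp (- alpha L / n) (X_i + dW_i),
    uniformly along almost every path ([scheme_cvg]).  In the recursion the
    increments dW_i can be integrated out one at a time, from the last to the
    first ([gauss_step]); this produces a Riccati recursion, linear in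
    projective coordinates ([scheme_laplace]), whose solution is a sum of two
    geometric sequences ([riccati_geometric]).  Bounded convergence then gives
    the Laplace transform of the limit.

    The value of the Ito integral ([ito_integral_value]) follows by summation by
    parts on the same grid ([left_sum_cvg]) from the convergence of the weighted
    quadratic variation of W to L in probability ([quadratic_sum_cvg]).

    Finally 1 / S is the integral of (theta + x) exp (- x (theta + x / 2) S) over
    x > 0 ([integral_inverse]), so that by Tonelli E[1 / S] and E[Q / S] are
    integrals of explicit functions of x ([integral_ratio],
    [terminal_laplace]).  These functions lie between quadratic polynomials
    times exp (- L x / 2) ([energy_density_bounds],
    [terminal_density_bounds]), and the integrals of the bounds are
    elementary. *)

(** * Gaussian integrals *)

Lemma bounded_integrable d (T : measurableType d) (R : realType)
    (mu : {finite_measure set T -> \bar R}) (f : T -> R) (M : R) :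
  measurable_fun setT f -> (forall x, `|f x| <= M) ->
  mu.-integrable setT (EFin \o f).
Proof.
move=> mf fM; apply: (@le_integrable _ _ _ mu _ measurableT _ (EFin \o cst M)).
- exact/measurable_EFinP.
- move=> x _ /=; rewrite lee_fin (le_trans (fM x))//.
  exact: ler_norm.
- exact: finite_measure_integrable_cst.
Qed.

Lemma measurable_fun_inv_ge0 d (T : measurableType d) (R : realType) (f : T -> R) :
  measurable_fun setT f -> (forall w, 0 <= f w) ->
  measurable_fun setT (fun w => (f w)^-1).
Proof.
move=> mf f0; have -> : (fun w => (f w)^-1) = (fun w => f w `^ (-1)).
  by apply/funext => w; rewrite powR_inv1.
exact: measurableT_comp (measurable_powR _) mf.
Qed.

(** Densities with respect to Lebesgue measure are Radon-Nikodym derivatives,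
    and the latter are unique almost everywhere. *)
Lemma integral_normal_prob (R : realType) (m s : R) (f : R -> \bar R) :
  (normal_prob m s).-integrable setT f ->
  (\int[normal_prob m s]_x f x =
   \int[lebesgue_measure]_x (f x * (normal_pdf m s x)%:E))%E.
Proof.
move=> fi.
have mpdf : measurable_fun setT (EFin \o normal_pdf m s).
  by apply/measurable_EFinP; exact: measurable_normal_pdf.
have mf := measurable_int _ fi.
rewrite -(Radon_Nikodym_change_of_variables (normal_prob_dominates m s))//=.
apply: ae_eq_integral => //.
- apply: emeasurable_funM => //; apply: (measurable_int lebesgue_measure).
  by apply: Radon_Nikodym_integrable; exact: normal_prob_dominates.
- exact: emeasurable_funM.
- apply: ae_eqe_mul2l.
  rewrite Radon_NikodymE//=; first exact: normal_prob_dominates.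
  move=> dom; case: cid => /= h [h1 h2 h3].
  by apply: integral_ae_eq => //= E _ mE; rewrite -h3.
Qed.

(** Completing the square turns the product of the integrand and the density
    of N(0, s^2) into a constant times a normal density of variance s^2 / (1 +
    2 c s^2). *)
Lemma gauss_laplace (R : realType) (s c y : R) : s != 0 -> 0 <= c ->
  (\int[normal_prob 0 s]_x (expR (- (c * (y + x) ^+ 2)))%:E =
   ((Num.sqrt (1 + 2 * c * s ^+ 2))^-1 *
     expR (- (c * y ^+ 2 / (1 + 2 * c * s ^+ 2))))%:E)%E.
Proof.
move=> s0 c0.
set v := 1 + 2 * c * s ^+ 2.
have v0 : 0 < v by rewrite ltr_pwDl// mulr_ge0 ?sqr_ge0// mulr_ge0//.
have mf : measurable_fun setT (fun x : R => expR (- (c * (y + x) ^+ 2))).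
  apply: measurableT_comp => //; apply: measurableT_comp => //.
  apply: measurable_funM => //; apply: measurable_funX.
  exact: measurable_funD.
rewrite integral_normal_prob; last first.
  apply: (@bounded_integrable _ _ _ (normal_prob 0 s) _ 1 mf) => x.
  rewrite ger0_norm ?expR_ge0// -expR0 ler_expR oppr_le0.
  by rewrite mulr_ge0 ?sqr_ge0.
(* Mean and standard deviation after completing the square. *)
set m' := - (2 * c * s ^+ 2 * y) / v.
set s' := s / Num.sqrt v.
have sv0 : 0 < Num.sqrt v by rewrite sqrtr_gt0.
have s'0 : s' != 0 by rewrite mulf_neq0// invr_eq0 gt_eqF.
have sv2 : Num.sqrt v ^+ 2 = v by rewrite sqr_sqrtr// ltW.
have peak : normal_peak s = (Num.sqrt v)^-1 * normal_peak s'.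
  rewrite /normal_peak -invfM -sqrtrM 1?ltW//; congr (Num.sqrt _)^-1.
  rewrite /s' expr_div_n sv2 -mulr_natr -[in RHS]mulr_natr; field.
  by rewrite gt_eqF.
have E x : ((expR (- (c * (y + x) ^+ 2)))%:E * (normal_pdf 0 s x)%:E =
  ((Num.sqrt v)^-1 * expR (- (c * y ^+ 2 / v)))%:E * (normal_pdf m' s' x)%:E)%E.
  rewrite -!EFinM !normal_pdfE// peak; congr (_%:E).
  transitivity ((Num.sqrt v)^-1 * normal_peak s' *
      (expR (- (c * (y + x) ^+ 2)) * normal_fun 0 s x)); first by ring.
  transitivity ((Num.sqrt v)^-1 * normal_peak s' *
      (expR (- (c * y ^+ 2 / v)) * normal_fun m' s' x)); last by ring.
  rewrite /normal_fun -!expRD; congr (_ * expR _).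
  rewrite /s' expr_div_n sv2 /m' /v; field.
  by rewrite -/v s0/= gt_eqF.
under eq_integral do rewrite E.
rewrite ge0_integralZl//.
- by rewrite integral_normal_pdf mule1.
- by apply/measurable_EFinP; exact: measurable_normal_pdf.
- by move=> x _; rewrite lee_fin normal_pdf_ge0.
Qed.

(** * Independence of an increment from the past *)

Section past.
Context d (T : measurableType d) (R : realType) (P : probability T R).
Variable xi : nat -> T -> R.
Hypothesis mxi : forall i, measurable_fun setT (xi i).

(** A pi-system that generates the sigma-algebra of the variables of index
    smaller than k. *)
Definition past_cylinders (k : nat) : set (set T) :=
  [set E | exists2 B : nat -> set R, (forall i, measurable (B i)) &
     E = [set w | forall i, (i < k)%N -> B i (xi i w)]].

(** Measurability of a function out of this type says that the function
    depends only on the variables of index smaller than k. *)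
Definition past_type (k : nat) := g_sigma_algebraType (past_cylinders k).

Lemma past_cylinders_measurable k : past_cylinders k `<=` measurable.
Proof.
move=> _ [B mB ->].
rewrite (_ : mkset _ = \bigcap_(i in `I_k) (xi i @^-1` B i)); last first.
  by apply/seteqP; split.
apply: bigcap_measurableType => i _; rewrite -[X in measurable X]setTI.
exact: mxi.
Qed.

Lemma past_measurable k (E : set T) : <<s past_cylinders k >> E -> measurable E.
Proof.
apply: smallest_sub; first exact: sigma_algebra_measurable.
exact: past_cylinders_measurable.
Qed.

Lemma past_measurable_fun d' (U : measurableType d') k (f : T -> U) :
  measurable_fun setT (f : past_type k -> U) -> measurable_fun setT f.
Proof.
by move=> mf _ B mB; apply: (@past_measurable k); exact: mf.
Qed.

Lemma past_measurable_xi k i : (i < k)%N ->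
  measurable_fun setT (xi i : past_type k -> R).
Proof.
move=> ik _ B mB; apply: sub_sigma_algebra.
exists (fun j => if j == i then B else setT).
  by move=> j; case: ifP.
apply/seteqP; split=> [w [_ Bw] j jk|w Bw].
  by case: eqP => // ->.
by split=> //; have := Bw _ ik; rewrite eqxx.
Qed.

Lemma past_measurable_fun_le d' (U : measurableType d') i k (f : T -> U) :
  (i <= k)%N -> measurable_fun setT (f : past_type i -> U) ->
  measurable_fun setT (f : past_type k -> U).
Proof.
move=> ik mf _ B mB.
suff : <<s past_cylinders i >> `<=` <<s past_cylinders k >>.
  by apply; exact: mf.
apply: smallest_sub => // E [C mC ->]; apply: sub_sigma_algebra.
exists (fun j => if (j < i)%N then C j else setT); first by move=> j; case: ifP.
apply/seteqP; split=> [w Cw j _|w Cw j ji].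
  by case: ifP => // ji; exact: Cw.
by have := Cw j (leq_trans ji ik); rewrite ji.
Qed.

(** Both sides are finite measures in E, and they agree on the cylinders by
    the product rule; the pi-lambda theorem extends the equality. *)
Lemma past_indep k (E : set T) (C : set R) :
  mutually_independent P (fun i : 'I_k.+1 => xi i) ->
  <<s past_cylinders k >> E -> measurable C ->
  P (E `&` xi k @^-1` C) = (P E * P (xi k @^-1` C))%E.
Proof.
move=> ind sE mC; set F := xi k @^-1` C.
have mF : measurable F by rewrite -[F]setTI; exact: mxi.
have PF0 : 0 <= fine (P F) by exact: fine_ge0.
have PFE : (fine (P F))%:E = P F by rewrite fineK// fin_num_measure.
have mrE A : mrestr P mF A = P (A `&` F) by [].
have msE A : mscale (NngNum PF0) P A = (P F * P A)%E.
  by rewrite /mscale/= PFE.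
suff : mrestr P mF E = mscale (NngNum PF0) P E.
  by rewrite mrE msE muleC.
apply: (@g_sigma_algebra_measure_unique _ _ _ (past_cylinders k) _
  (fun=> setT)) sE => //.
- exact: past_cylinders_measurable.
- by move=> _; exists (fun=> setT) => //; apply/seteqP; split.
- by rewrite bigcup_const.
- move=> _ _ [A mA ->] [B mB ->]; exists (fun i => A i `&` B i).
    by move=> i; exact: measurableI.
  apply/seteqP; split=> [w [Aw Bw] i ik|w ABw].
    by split; [exact: Aw|exact: Bw].
  by split=> i /ABw[].
- move=> _ [B mB ->]; rewrite [LHS]mrE [RHS]msE.
  (* The product rule is used with C, then with the whole line, as last set. *)
  pose B' (i : 'I_k.+1) := if (i < k)%N then B i else C.
  pose B'' (i : 'I_k.+1) := if (i < k)%N then B i else setT.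
  have E' : [set w | forall i : 'I_k.+1, B' i (xi i w)] =
            [set w | forall i, (i < k)%N -> B i (xi i w)] `&` F.
    apply/seteqP; split=> [w Bw|w [Bw Cw] i]; last first.
      rewrite /B'; case: ltnP => [ik|ki]; first exact: Bw.
      by have -> : i = k :> nat by apply/eqP; rewrite eqn_leq ki -ltnS ltn_ord.
    split=> [i ik|].
      by have := Bw (Ordinal (leqW ik)); rewrite /B' /= ik.
    by have := Bw ord_max; rewrite /B' /= ltnn.
  have E'' : [set w | forall i : 'I_k.+1, B'' i (xi i w)] =
            [set w | forall i, (i < k)%N -> B i (xi i w)].
    apply/seteqP; split=> [w Bw i ik|w Bw i]; last first.
      by rewrite /B''; case: ltnP => [ik|//]; exact: Bw.
    by have := Bw (Ordinal (leqW ik)); rewrite /B'' /= ik.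
  rewrite -E' -E'' !ind; last 2 first.
  - by move=> i; rewrite /B''; case: ifP.
  - by move=> i; rewrite /B'; case: ifP.
  rewrite !big_ord_recr/= /B' /B'' !ltnn preimage_setT probability_setT mule1.
  rewrite muleC; congr (_ * _)%E; apply: eq_bigr => i _ /=.
  by rewrite ltn_ord.
- move=> _; apply: (@le_lt_trans _ _ 1%E); last exact: ltry.
  by apply: probability_le1; exact: measurableI.
Qed.

(** The joint law of Z and xi k is the product of their laws, so that by
    Tonelli xi k can be integrated out first. *)
Lemma integral_past_indep d' (U : measurableType d') k (Z : T -> U)
    (nu : probability (measurableTypeR R) R) (f : U * measurableTypeR R -> \bar R) :
  mutually_independent P (fun i : 'I_k.+1 => xi i) ->
  (forall B : set R, measurable B -> P (xi k @^-1` B) = nu B) ->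
  measurable_fun setT (Z : past_type k -> U) ->
  measurable_fun setT f -> (forall z, (0 <= f z)%E) ->
  (\int[P]_w f (Z w, xi k w) = \int[P]_w \int[nu]_y f (Z w, y))%E.
Proof.
move=> ind law mZ mf f0.
have mZ' : measurable_fun setT Z by exact: past_measurable_fun mZ.
have mxi' : measurable_fun setT (xi k : T -> measurableTypeR R) by exact: mxi.
have mp : measurable_fun setT (fun w => (Z w, xi k w : measurableTypeR R)).
  exact: measurable_fun_pair.
pose Zm : {mfun T >-> U} := HB.pack Z (isMeasurableFun.Build _ _ _ _ Z mZ').
pose pm : {mfun T >-> (U * measurableTypeR R)%type} :=
  HB.pack (fun w => (Z w, xi k w : measurableTypeR R))
    (isMeasurableFun.Build _ _ _ _ (fun w => (Z w, xi k w : measurableTypeR R)) mp).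
transitivity (\int[distribution P pm]_z f z)%E.
  by rewrite ge0_integral_distribution.
transitivity (\int[distribution P Zm]_z \int[nu]_y f (z, y))%E; last first.
  rewrite ge0_integral_distribution//.
    exact: (@measurable_fun_fubini_tonelli_F _ _ _ _ _ nu).
  by move=> z; exact: integral_ge0.
transitivity (\int[distribution P Zm \x nu]_z f z)%E; last first.
  exact: fubini_tonelli1.
apply: eq_measure_integral => A mA _; apply/esym.
apply: product_measure_unique => // B C mB mC.
transitivity (P (Z @^-1` B `&` xi k @^-1` C)); first by [].
transitivity (P (Z @^-1` B) * P (xi k @^-1` C))%E; last first.
  by congr (_ * _)%E; exact: law.
by apply: past_indep => //; rewrite -[_ @^-1` B]setTI; exact: mZ.
Qed.

End past.

(** * Laplace transforms of Gaussian recursions *)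

Section gaussian_steps.
Context d (T : measurableType d) (R : realType) (P : probability T R).
Variable xi : nat -> T -> R.
Hypothesis mxi : forall i, measurable_fun setT (xi i).

(** Integrating the newest increment out keeps the integrand the exponential
    of a quadratic form, and replaces c by c / (1 + 2 c s^2). *)
Lemma gauss_step k (s c : R) (V Z : T -> R) : s != 0 -> 0 <= c ->
  mutually_independent P (fun i : 'I_k.+1 => xi i) ->
  (forall B : set R, measurable B -> P (xi k @^-1` B) = normal_prob 0 s B) ->
  measurable_fun setT (V : past_type xi k -> R) ->
  measurable_fun setT (Z : past_type xi k -> R) ->
  let v := 1 + 2 * c * s ^+ 2 in
  (\int[P]_w (expR (- (V w + c * (Z w + xi k w) ^+ 2)))%:E =
   ((Num.sqrt v)^-1)%:E *
     \int[P]_w (expR (- (V w + c / v * Z w ^+ 2)))%:E)%E.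
Proof.
move=> s0 c0 ind law mV mZ v.
pose f (z : (R * R) * measurableTypeR R) :=
  (expR (- (z.1.1 + c * (z.1.2 + z.2) ^+ 2)))%:E.
have m2 : measurable_fun setT (fun z : (R * R) * measurableTypeR R => z.2 : R).
  exact: measurable_snd.
have mf : measurable_fun setT f.
  apply/measurable_EFinP; apply: measurableT_comp => //.
  apply: measurableT_comp => //; apply: measurable_funD.
    exact: (measurableT_comp measurable_fst measurable_fst).
  apply: measurable_funM => //; apply: measurable_funX.
  apply: measurable_funD => //.
  exact: (measurableT_comp measurable_snd measurable_fst).
have mVZ : measurable_fun setT (fun w : past_type xi k => (V w, Z w)).
  exact: measurable_fun_pair.
have f0 z : (0 <= f z)%E by rewrite lee_fin expR_ge0.
have := integral_past_indep mxi ind law mVZ mf f0.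
rewrite /f /= => ->.
have v0 : 0 < v by rewrite ltr_pwDl// mulr_ge0 ?sqr_ge0// mulr_ge0.
rewrite -ge0_integralZl//; last first.
  apply/measurable_EFinP; apply: measurableT_comp => //.
  apply: measurableT_comp => //; apply: measurable_funD.
    exact: past_measurable_fun mV.
  apply: measurable_funM => //; apply: measurable_funX.
  exact: past_measurable_fun mZ.
apply: eq_integral => w _.
under eq_integral do rewrite opprD expRD EFinM.
rewrite ge0_integralZl//=; last first.
  apply/measurable_EFinP; apply: measurableT_comp => //.
  apply: measurableT_comp => //.
  by apply: measurable_funM => //; apply: measurable_funX; exact: measurable_funD.
rewrite gauss_laplace// -!EFinM; congr (_%:E).
rewrite mulrCA -expRD -opprD; congr (_ * expR (- (_ + _))).
by rewrite mulrAC.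
Qed.

Variable s : nat -> R.
Hypothesis ind : forall k, mutually_independent P (fun i : 'I_k.+1 => xi i).
Hypothesis s0 : forall k, s k != 0.
Hypothesis law : forall k (B : set R), measurable B ->
  P (xi k @^-1` B) = normal_prob 0 (s k) B.

Lemma squares_laplace (a tau : R) (b : nat -> R) k : 0 <= a ->
  (forall i, 0 <= b i) ->
  (forall i, b i * s i ^+ 2 = tau) ->
  (\int[P]_w (expR (- (a * \sum_(i < k) b i * xi i w ^+ 2)))%:E =
   ((Num.sqrt (1 + 2 * a * tau))^-1 ^+ k)%:E)%E.
Proof.
move=> a0 b0 bs; elim: k => [|k IH].
  under eq_integral do rewrite big_ord0 mulr0 oppr0 expR0.
  by rewrite integral_cst// mul1e [LHS]probability_setT expr0.
under eq_integral => w _.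
  rewrite big_ord_recr/= mulrDr -[xi k w]add0r [a * (b k * _)]mulrA.
  over.
have mV : measurable_fun setT
    ((fun w => a * \sum_(i < k) b i * xi i w ^+ 2) : past_type xi k -> R).
  apply: measurable_funM => //; apply: measurable_sum => i.
  apply: measurable_funM => //; apply: measurable_funX.
  exact: past_measurable_xi.
have abk : 0 <= a * b k by rewrite mulr_ge0.
rewrite (gauss_step (s0 k) abk (@ind k) (@law k) mV); last first.
  exact: measurable_cst.
under eq_integral do rewrite expr0n mulr0 addr0.
have -> : 1 + 2 * (a * b k) * s k ^+ 2 = 1 + 2 * a * tau.
  by rewrite -(bs k); ring.
by rewrite IH// -EFinM [in RHS]exprS.
Qed.

(** The decay factor a = exp (- alpha h) is the exact one, ((1 - t_(i+1)) / (1
    - t_i))^alpha, over a cell of length h in the clock - ln (1 - t); only the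
    place where the noise of the cell enters is approximated. *)
Fixpoint scheme (a : R) (dw : nat -> R) (k : nat) : R :=
  if k is k'.+1 then a * (scheme a dw k' + dw k') else 0.

(** Backward recursion for the coefficient c = p / q of the squared last state
    when increments are integrated out. The map c |-> kap + m c / (1 + 2 m tau
    c) is a homography, hence linear in (q, p), and 1 + 2 m tau c is the
    quotient of consecutive values of q, so that the normalising constants
    telescope. *)
Fixpoint riccati (kap m tau : R) (k : nat) (q p : R) : R :=
  if k is k'.+1 then
    let q' := q + 2 * m * tau * p in riccati kap m tau k' q' (kap * q' + m * p)
  else q.

Lemma riccati_gt0 (kap m tau q p : R) k : 0 <= kap -> 0 <= m -> 0 <= tau ->
  0 < q -> 0 <= p -> 0 < riccati kap m tau k q p.
Proof.
move=> kap0 m0 tau0; elim: k q p => [//|k IH] q p q0 p0 /=.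
have q'0 : 0 < q + 2 * m * tau * p.
  by rewrite ltr_pwDl// mulr_ge0// mulr_ge0// mulr_ge0.
by apply: IH => //; rewrite addr_ge0// mulr_ge0// ltW.
Qed.

Lemma past_measurable_scheme (a : R) k :
  measurable_fun setT
    ((fun w => scheme a (xi ^~ w) k) : past_type xi k -> R).
Proof.
elim: k => [|k IH]; first exact: measurable_cst.
apply: measurable_funM => //; apply: measurable_funD.
  exact: past_measurable_fun_le IH.
exact: past_measurable_xi.
Qed.

(** One application of [gauss_step] per increment. The initial pair (q, p) is
    arbitrary because it changes at every step of the induction. *)
Lemma scheme_laplace (a b kap tau q p : R) k :
  0 <= a -> 0 < b -> 0 <= kap -> 0 <= tau -> 0 < q -> 0 <= p ->
  (forall i, b ^+ i * s i ^+ 2 = tau) ->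
  (\int[P]_w (expR (- (kap * (\sum_(i < k) b ^+ i * scheme a (xi ^~ w) i ^+ 2)
     + p / q * (b ^+ k * scheme a (xi ^~ w) k ^+ 2))))%:E =
   (Num.sqrt q / Num.sqrt (riccati kap (a ^+ 2 * b) tau k q p))%:E)%E.
Proof.
move=> a0 b0 kap0 tau0 + + bs; elim: k q p => [|k IH] q p q0 p0.
  under eq_integral do rewrite big_ord0 /= expr0n/= !mulr0 addr0 oppr0 expR0.
  by rewrite integral_cst// mul1e [LHS]probability_setT divff// gt_eqF// sqrtr_gt0.
set m := a ^+ 2 * b; set q' := q + 2 * m * tau * p.
have m0 : 0 <= m by rewrite /m mulr_ge0 ?sqr_ge0// ltW.
have q'0 : 0 < q' by rewrite /q' ltr_pwDl// mulr_ge0// mulr_ge0// mulr_ge0.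
have p'0 : 0 <= kap * q' + m * p.
  by rewrite addr_ge0// mulr_ge0// ltW.
pose c := p / q * b ^+ k.+1 * a ^+ 2.
have c0 : 0 <= c.
  by rewrite /c mulr_ge0 ?sqr_ge0// mulr_ge0 ?exprn_ge0 ?divr_ge0// ltW.
under eq_integral => w _.
  rewrite big_ord_recr/= (_ : - _ = - (kap * (\sum_(i < k) b ^+ i *
    scheme a (xi ^~ w) i ^+ 2 + b ^+ k * scheme a (xi ^~ w) k ^+ 2) +
    c * (scheme a (xi ^~ w) k + xi k w) ^+ 2)); last by rewrite /c; ring.
  over.
have mZ := @past_measurable_scheme a k.
have mV : measurable_fun setT
    ((fun w => kap * (\sum_(i < k) b ^+ i * scheme a (xi ^~ w) i ^+ 2
      + b ^+ k * scheme a (xi ^~ w) k ^+ 2)) : past_type xi k -> R).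
  apply: measurable_funM => //; apply: measurable_funD.
    apply: measurable_sum => i; apply: measurable_funM => //.
    apply: measurable_funX.
    apply: (past_measurable_fun_le (ltnW (ltn_ord i))).
    exact: past_measurable_scheme.
  by apply: measurable_funM => //; apply: measurable_funX.
rewrite (gauss_step (s0 k) c0 (@ind k) (@law k) mV mZ).
have bk0 : b ^+ k != 0 by rewrite gt_eqF// exprn_gt0.
have vE : 1 + 2 * c * s k ^+ 2 = q' / q.
  rewrite /c /q' /m -(bs k) [b ^+ k.+1]exprS; field.
  by rewrite gt_eqF.
rewrite vE.
under eq_integral => w _.
  rewrite (_ : _ + _ = kap * (\sum_(i < k) b ^+ i * scheme a (xi ^~ w) i ^+ 2)
    + (kap * q' + m * p) / q' * (b ^+ k * scheme a (xi ^~ w) k ^+ 2)); last first.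
    rewrite /c /m [b ^+ k.+1]exprS; field.
    by rewrite !gt_eqF.
  over.
rewrite IH// -EFinM; congr (_%:E) => /=.
rewrite -/m -/q' sqrtrM ?ltW// sqrtrV ?ltW//; field.
by rewrite !sqrtr_eq0 -!ltNge q0 q'0 riccati_gt0.
Qed.

End gaussian_steps.

(** * Solution and limit of the Riccati recursion *)

Section riccati_limit.
Context {R : realType}.

(** The coefficients are the trace and the determinant of the 2 x 2 matrix of
    one step. *)
Lemma riccati_recurrence (kap m tau : R) (u : nat -> R) j k :
  m != 0 -> tau != 0 ->
  (forall i, u i.+2 = (1 + m + 2 * kap * m * tau) * u i.+1 - m * u i) ->
  riccati kap m tau k (u j) ((u j.+1 - u j) / (2 * m * tau)) = u (j + k)%N.
Proof.
move=> m0 tau0 uE; elim: k j => [|k IH] j /=; first by rewrite addn0.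
have -> : u j + 2 * m * tau * ((u j.+1 - u j) / (2 * m * tau)) = u j.+1.
  by field; rewrite tau0 m0.
rewrite -addSnnS -IH uE; congr (riccati _ _ _ _ _ _).
by field; rewrite tau0 m0.
Qed.

(** The weight for which the characteristic roots of the recursion are exactly
    exp (x h) and exp (- (2 theta + x) h). It is equivalent to the natural
    weight h x (theta + x / 2) as h tends to 0, and it makes the recursion
    solvable in closed form at every h. *)
Definition kappa (theta x h : R) : R :=
  (expR (x * h) - 1) * (1 - expR (- ((theta *+ 2 + x) * h))) /
  (2 * expR (- (theta *+ 2 * h)) * (1 - expR (- h))).

(** The value at L of the solution of q'' + 2 theta q' = x (2 theta + x) q
    with q(0) = 1 and q'(0) = 2 mu. *)
Definition riccati_lim (theta x mu L : R) : R :=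
  ((2 * theta + x + 2 * mu) * expR (x * L) +
   (x - 2 * mu) * expR (- ((theta *+ 2 + x) * L))) / (2 * (theta + x)).

Lemma kappa_ge0 (theta x h : R) : 0 < theta -> 0 < x -> 0 < h ->
  0 <= kappa theta x h.
Proof.
move=> theta0 x0 h0; rewrite /kappa divr_ge0//.
  rewrite mulr_ge0// subr_ge0; first by rewrite -expR0 ler_expR mulr_ge0// ltW.
  by rewrite -expR0 ler_expR oppr_le0 mulr_ge0 ?addr_ge0 ?mulrn_wge0// ltW.
rewrite !mulr_ge0 ?expR_ge0//.
by rewrite subr_ge0 -expR0 ler_expR oppr_le0 ltW.
Qed.

Lemma riccati_lim_gt0 (theta x mu L : R) : 0 < theta -> 0 < x -> 0 <= mu ->
  0 < L -> 0 < riccati_lim theta x mu L.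
Proof.
move=> theta0 x0 mu0 L0; rewrite /riccati_lim divr_gt0//; last first.
  by rewrite mulr_gt0// addr_gt0.
set A := expR (x * L); set B := expR _.
have A0 : 0 < A by exact: expR_gt0.
have B0 : 0 < B by exact: expR_gt0.
have AB : 0 <= A - B.
  rewrite subr_ge0 ler_expR -mulNr ler_wpM2r ?(ltW L0)//.
  by rewrite mulr2n; lra.
have -> : (2 * theta + x + 2 * mu) * A + (x - 2 * mu) * B =
    2 * theta * A + (x * A + (x * B + 2 * mu * (A - B))) by ring.
rewrite addr_gt0 ?mulr_gt0// addr_gt0 ?mulr_gt0// ltr_wpDr ?mulr_gt0//.
by rewrite mulr_ge0// mulr_ge0.
Qed.

Lemma riccati_geometric (theta x mu h : R) n :
  0 < theta -> 0 < x -> 0 < h ->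
  let l1 := expR (x * h) in
  let l2 := expR (- ((theta *+ 2 + x) * h)) in
  let m := expR (- (theta *+ 2 * h)) in
  let tau := 1 - expR (- h) in
  riccati (kappa theta x h) m tau n 1 mu =
  ((1 + 2 * m * tau * mu - l2) * l1 ^+ n +
   (l1 - 1 - 2 * m * tau * mu) * l2 ^+ n) / (l1 - l2).
Proof.
move=> theta0 x0 h0 l1 l2 m tau.
have ml : m = l1 * l2.
  by rewrite /l1 /l2 /m -expRD; congr expR; ring.
have m0 : m != 0 by rewrite gt_eqF// expR_gt0.
have tau0 : tau != 0.
  by rewrite subr_eq0 eq_sym lt_eqF// expR_lt1 oppr_lt0.
have l12 : l1 - l2 != 0.
  rewrite subr_eq0 gt_eqF// ltr_expR -subr_gt0 opprK -mulrDl mulr_gt0//.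
  by rewrite !addr_gt0// mulrn_wgt0.
pose u (i : nat) := ((1 + 2 * m * tau * mu - l2) * l1 ^+ i +
   (l1 - 1 - 2 * m * tau * mu) * l2 ^+ i) / (l1 - l2).
rewrite -[RHS]/(u n) -(add0n n) -(@riccati_recurrence (kappa theta x h) m tau)//.
  rewrite add0n; congr riccati; rewrite /u /= ?expr0 ?expr1; field.
    exact: l12.
  by rewrite l12 tau0 m0.
move=> i; rewrite /u /kappa -/m -/l1 -/l2 -/tau !exprS ml; field.
by rewrite l12 tau0 !gt_eqF ?expR_gt0.
Qed.

(** Squeeze: 1 + a h <= exp (a h) <= 1 / (1 - a h). *)
Lemma expR_slope_cvg (h : nat -> R) (a : R) :
  (forall n, 0 < h n) -> h @ \oo --> 0 ->
  (expR (a * h n) - 1) / h n @[n --> \oo] --> a.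
Proof.
move=> h0 hcvg.
have ahcvg : 1 - a * h n @[n --> \oo] --> (1 : R).
  rewrite -[X in _ --> X]subr0; apply: cvgB; first exact: cvg_cst.
  by rewrite -[X in _ --> X](mulr0 a); apply: cvgM => //; exact: cvg_cst.
apply: (@squeeze_cvgr _ _ _ _ (cst a) (fun n => a / (1 - a * h n))).
- near=> n.
  have d0 : 0 < 1 - a * h n.
    by near: n; apply: (cvgr_gt (1 : R)).
  have h0n := h0 n.
  rewrite /cst ler_pdivlMr// lerBrDl expR_ge1Dx/= ler_pdivrMr//.
  rewrite lerBlDl.
  have -> : 1 + a / (1 - a * h n) * h n = (1 - a * h n)^-1.
    by field; rewrite gt_eqF.
  rewrite -[expR _]invrK lef_pV2 ?posrE ?invr_gt0 ?expR_gt0//.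
  by rewrite -expRN; exact: expR_ge1Dx.
- exact: cvg_cst.
- rewrite -[X in _ --> X]mulr1 -[in X in _ --> X]invr1.
  by apply: cvgM; [exact: cvg_cst|apply: cvgV => //; exact: oner_neq0].
Unshelve. all: by end_near. Qed.

Lemma one_sub_expR_slope_cvg (h : nat -> R) (a : R) :
  (forall n, 0 < h n) -> h @ \oo --> 0 ->
  (1 - expR (- (a * h n))) / h n @[n --> \oo] --> a.
Proof.
move=> h0 hcvg; rewrite -[X in _ --> X]opprK.
have -> : (fun n => (1 - expR (- (a * h n))) / h n) =
    (fun n => - ((expR (- a * h n) - 1) / h n)).
  by apply/funext => n; rewrite -[RHS]mulNr opprB mulNr.
by apply: cvgN; exact: expR_slope_cvg.
Qed.

Lemma kappa_cvg (h : nat -> R) (theta x : R) :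
  (forall n, 0 < h n) -> h @ \oo --> 0 ->
  kappa theta x (h n) / h n @[n --> \oo] --> x * (theta + x / 2).
Proof.
move=> h0 hcvg.
have ecvg : expR (- (theta *+ 2 * h n)) @[n --> \oo] --> (1 : R).
  rewrite -[X in _ --> X]expR0.
  apply: (cvg_comp _ expR); last exact: continuous_expR.
  rewrite -oppr0; apply: cvgN; rewrite -[X in _ --> X](mulr0 (theta *+ 2)).
  by apply: cvgM => //; exact: cvg_cst.
have -> : (fun n => kappa theta x (h n) / h n) = (fun n =>
    ((expR (x * h n) - 1) / h n *
     ((1 - expR (- ((theta *+ 2 + x) * h n))) / h n)) *
    (2 * expR (- (theta *+ 2 * h n)) * ((1 - expR (- (1 * h n))) / h n))^-1).
  apply/funext => n; rewrite /kappa mul1r.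
  have t0 : 1 - expR (- h n) != 0.
    by rewrite subr_eq0 eq_sym lt_eqF// expR_lt1 oppr_lt0.
  by field; rewrite t0 !gt_eqF ?expR_gt0.
have -> : x * (theta + x / 2) =
    x * (theta *+ 2 + x) * (2 * 1 * 1)^-1.
  by rewrite mulr2n; field.
apply: cvgM.
  by apply: cvgM; [exact: expR_slope_cvg|exact: one_sub_expR_slope_cvg].
apply: cvgV; first by rewrite !mulr1 pnatr_eq0.
apply: cvgM; last exact: one_sub_expR_slope_cvg.
by apply: cvgM => //; exact: cvg_cst.
Qed.

Lemma riccati_cvg (theta x mu L : R) : 0 < theta -> 0 < x -> 0 < L ->
  let h n := L / n.+1%:R in
  riccati (kappa theta x (h n)) (expR (- (theta *+ 2 * h n)))
    (1 - expR (- h n)) n.+1 1 mu @[n --> \oo] --> riccati_lim theta x mu L.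
Proof.
move=> theta0 x0 L0 h.
have h0 n : 0 < h n by rewrite divr_gt0.
have hcvg : h @ \oo --> 0.
  rewrite -(mulr0 L); apply: cvgM; first exact: cvg_cst.
  exact: cvg_harmonic.
have ecvg : expR (- (theta *+ 2 * h n)) @[n --> \oo] --> (1 : R).
  rewrite -[X in _ --> X]expR0.
  apply: (cvg_comp _ expR); last exact: continuous_expR.
  rewrite -oppr0; apply: cvgN; rewrite -[X in _ --> X](mulr0 (theta *+ 2)).
  by apply: cvgM => //; exact: cvg_cst.
pose sx n := (expR (x * h n) - 1) / h n.
pose st n := (1 - expR (- (1 * h n))) / h n.
pose s2 n := (1 - expR (- ((theta *+ 2 + x) * h n))) / h n.
have hL n : h n * n.+1%:R = L by rewrite /h divfK.
have -> : (fun n => riccati (kappa theta x (h n)) (expR (- (theta *+ 2 * h n)))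
    (1 - expR (- h n)) n.+1 1 mu) = (fun n =>
    ((s2 n + 2 * expR (- (theta *+ 2 * h n)) * st n * mu) * expR (x * L) +
     (sx n - 2 * expR (- (theta *+ 2 * h n)) * st n * mu) *
       expR (- ((theta *+ 2 + x) * L))) * (sx n + s2 n)^-1).
  have eL a n : expR (a * h n) ^+ n.+1 = expR (a * L).
    by rewrite -expRM_natr -mulrA hL.
  apply/funext => n; rewrite riccati_geometric//.
  rewrite -![in LHS]mulNr !eL /sx /s2 /st mul1r -![in RHS]mulNr.
  field.
  have xh : 1 < expR (x * h n) by rewrite expR_gt1 mulr_gt0.
  have th : expR (- (theta *+ 2 + x) * h n) < 1.
    by rewrite expR_lt1 mulNr oppr_lt0 mulr_gt0// addr_gt0// mulrn_wgt0.
  by rewrite !gt_eqF//; apply: addr_gt0; rewrite subr_gt0.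
have -> : riccati_lim theta x mu L =
    ((theta *+ 2 + x + 2 * 1 * 1 * mu) * expR (x * L) +
     (x - 2 * 1 * 1 * mu) * expR (- ((theta *+ 2 + x) * L))) *
    (x + (theta *+ 2 + x))^-1.
  rewrite /riccati_lim !mulr1 mulr2n; congr (_ / _); ring.
have cx : sx n @[n --> \oo] --> x by exact: expR_slope_cvg.
have ct : st n @[n --> \oo] --> (1 : R) by exact: one_sub_expR_slope_cvg.
have c2 : s2 n @[n --> \oo] --> theta *+ 2 + x.
  exact: one_sub_expR_slope_cvg.
have cm : 2 * expR (- (theta *+ 2 * h n)) * st n * mu @[n --> \oo] -->
    2 * 1 * 1 * mu.
  apply: cvgM; last exact: cvg_cst.
  by apply: cvgM => //; apply: cvgM => //; exact: cvg_cst.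
apply: cvgM.
  apply: cvgD; apply: cvgM; try exact: cvg_cst.
    exact: cvgD.
  exact: cvgB.
apply: cvgV; last exact: cvgD.
by rewrite gt_eqF// !addr_gt0// mulrn_wgt0.
Qed.

End riccati_limit.

(** * Logarithmic clock, grids and Riemann sums *)

Section log_weight.
Context {R : realType}.
Notation mu := (@lebesgue_measure R).

(** Heine's theorem, by the covering form of compactness. *)
Lemma segment_unif_continuous (f : R -> R) (a b e : R) :
  {within `[a, b], continuous f} -> 0 < e ->
  exists2 delta, 0 < delta & forall s t, s \in `[a, b] -> t \in `[a, b] ->
    `|s - t| < delta -> `|f s - f t| <= e.
Proof.
move=> cf e0.
have e20 : 0 < e / 2 by rewrite divr_gt0.
have := @segment_compact _ a b; rewrite compact_near_coveringP => cov.
have /nbhs_right0P[_/posnumP[delta] deltaP] : \forall delta \near (0 : R)^'+,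
    `[a, b] `<=` (fun s => s \in `[a, b] -> forall t, t \in `[a, b] ->
      `|s - t| < delta -> `|f s - f t| <= e).
  apply: cov => x xab.
  have : \forall t \near within `[a, b] (nbhs x), `|f x - f t| < e / 2.
    by move/subspace_continuousP : cf => /(_ x xab)/cvgrPdist_lt; exact.
  case/nbhs_ballP => r /= r0 rP.
  exists (ball x (r / 2), [set delta | delta < r / 2]) => /=.
    split; first by apply: nbhsx_ballx; rewrite divr_gt0.
    by apply: nbhs_right_lt; rewrite divr_gt0.
  move=> [y delta] /= [xy dr] yab t tab yt.
  have xt : ball x r t.
    rewrite /ball/= (splitr r) (le_lt_trans (ler_distD y _ _))//.
    by rewrite ltrD// (lt_trans yt).
  have xy' : ball x r y.
    by apply: le_ball xy; rewrite ler_pdivrMr// ler_peMr// ?ler1n// ltW.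
  rewrite (le_trans (ler_distD (f x) _ _))// (splitr e) lerD// ltW//.
    by rewrite distrC; exact: rP.
  exact: rP.
exists (delta%:num / 2) => //.
move=> s t sab tab st; apply: (deltaP (delta%:num / 2)) => //.
  rewrite /ball_/= sub0r normrN gtr0_norm// ltr_pdivrMr// ltr_pMr// ltr1n//.
by rewrite add0r.
Qed.

Lemma log_weight_cst (a b : R) : a <= b -> b < 1 ->
  \int[mu]_(s in `[a, b]) (1 - s)^-1 = ln (1 - a) - ln (1 - b).
Proof.
move=> ab b1; have [abE|abN] := eqVneq a b.
  by rewrite abE set_itv1 Rintegral_set1 subrr.
have {}ab : a < b by rewrite lt_neqAle abN.
have s1 (s : R) : s <= b -> 0 < 1 - s.
  by move=> sb; rewrite subr_gt0 (le_lt_trans sb).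
have d1 (s : R) : is_derive s 1 (fun s : R => 1 - s) (-1).
  by have := is_deriveB (is_derive_cst (1 : R) s 1) (is_derive_id s (1 : R)); rewrite sub0r.
have cf : {within `[a, b], continuous (fun s : R => (1 - s)^-1)}.
  apply/subspace_continuousP => s /=; rewrite in_itv/= => /andP[_ /s1 s0].
  apply: cvg_within_filter; apply: cvgV; first by rewrite gt_eqF.
  by apply: cvgB; [exact: cvg_cst|exact: cvg_id].
have dF (s : R) : s <= b -> is_derive s 1 (fun s : R => - ln (1 - s)) (1 - s)^-1.
  move=> /s1 s10.
  have H := @is_derive1_comp _ (@ln R) (fun s => 1 - s) _ _ _ (is_derive1_ln s10) (d1 s).
  have := is_deriveN H; rewrite mulrN1 opprK; exact.
rewrite /Rintegral (@continuous_FTC2 _ _ (fun s => - ln (1 - s)))//=.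
- by ring.
- have cF : {within `[a, b], continuous (fun s : R => - ln (1 - s))}.
    apply: derivable_within_continuous => s; rewrite in_itv/= => /andP[_ sb].
    by have [] := dF _ sb.
  have [_ Fa Fb] := (continuous_within_itvP _ ab).1 cF.
  split=> // s; rewrite in_itv/= => /andP[_ /ltW sb].
  by have [] := dF _ sb.
- move=> s; rewrite in_itv/= => /andP[_ /ltW sb].
  by rewrite derive1E; have [_] := dF _ sb.
Qed.

Lemma continuous_onem_inv (a b : R) : b < 1 ->
  {within `[a, b], continuous (fun s : R => (1 - s)^-1)}.
Proof.
move=> b1; apply/subspace_continuousP => s /=; rewrite in_itv/= => /andP[_ sb].
apply: cvg_within_filter; apply: cvgV.
  by rewrite subr_eq0 gt_eqF// (le_lt_trans sb).
by apply: cvgB; [exact: cvg_cst|exact: cvg_id].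
Qed.

Lemma log_weight_integrable (f : R -> R) (a b : R) : b < 1 ->
  {within `[a, b], continuous f} ->
  mu.-integrable `[a, b] (EFin \o (fun s => f s / (1 - s))).
Proof.
move=> b1 cf; apply: continuous_compact_integrable; first exact: segment_compact.
by move=> s; apply: cvgM; [exact: cf|exact: continuous_onem_inv].
Qed.

(** The weight 1 / (1 - s) is the density of the clock - ln (1 - s), so the
    integral of a function within e of c is within e times the elapsed clock
    time of c times that time. *)
Lemma log_weight_dev (f : R -> R) (a b c e : R) : a <= b -> b < 1 ->
  {within `[a, b], continuous f} ->
  (forall s, s \in `[a, b] -> `|f s - c| <= e) ->
  `|\int[mu]_(s in `[a, b]) (f s / (1 - s)) - c * (ln (1 - a) - ln (1 - b))| <=
  e * (ln (1 - a) - ln (1 - b)).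
Proof.
move=> ab b1 cf fe.
have icst (k : R) : mu.-integrable `[a, b] (EFin \o (fun s => k / (1 - s))).
  by apply: log_weight_integrable => // s; exact: cvg_cst.
have Ecst (k : R) : \int[mu]_(s in `[a, b]) (k / (1 - s)) =
    k * (ln (1 - a) - ln (1 - b)).
  rewrite RintegralZl ?log_weight_cst//.
  have := icst 1; apply: eq_integrable => // s _ /=.
  by rewrite mul1r.
rewrite -!Ecst -RintegralB//; last exact: log_weight_integrable.
have icf : mu.-integrable `[a, b] (EFin \o (fun s => (f s - c) / (1 - s))).
  apply: log_weight_integrable => // s; apply: cvgB; first exact: cf.
  exact: cvg_cst.
under eq_Rintegral do rewrite -mulrBl.
apply: (le_trans (le_normr_Rintegral _ icf)) => //.
apply: le_Rintegral => //.
  exact: (integrable_abse icf).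
move=> s /= sab; rewrite normrM ler_pM//; first exact: fe.
move: sab; rewrite in_itv/= => /andP[_ sb].
by rewrite ger0_norm// invr_ge0 subr_ge0 (le_trans sb)// ltW.
Qed.

Lemma log_weight_increment (f : R -> R) (a b c e : R) :
  0 <= a -> a <= b -> b < 1 ->
  {within `[0, b], continuous f} ->
  (forall s, s \in `[a, b] -> `|f s - c| <= e) ->
  `|\int[mu]_(s in `[0, b]) (f s / (1 - s)) -
    \int[mu]_(s in `[0, a]) (f s / (1 - s)) - c * (ln (1 - a) - ln (1 - b))| <=
  e * (ln (1 - a) - ln (1 - b)).
Proof.
move=> a0 ab b1 cf fe.
have sub : `[a, b] `<=` `[0, b] by apply: subset_itvr; rewrite bnd_simp.
rewrite Rintegral_itvB ?bnd_simp//; last exact: log_weight_integrable.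
rewrite Rintegral_itv_obnd_cbnd; last first.
  apply: integrableS (log_weight_integrable b1 cf) => //.
  by apply: subset_trans sub; apply: subset_itvr; rewrite bnd_simp.
by apply: log_weight_dev => //; exact: continuous_subspaceW cf.
Qed.

(** Equidistant in the clock - ln (1 - t): the factors 1 - t_i and the
    variances of the Brownian increments are then geometric in i. *)
Definition grid (h : R) (i : nat) : R := 1 - expR (- (i%:R * h)).

Lemma ln_one_sub_grid h i : ln (1 - grid h i) = - (i%:R * h).
Proof. by rewrite /grid opprB addrC subrK expRK. Qed.

Lemma grid0 h : grid h 0 = 0.
Proof. by rewrite /grid mul0r oppr0 expR0 subrr. Qed.

Lemma grid_lt1 h i : grid h i < 1.
Proof. by rewrite /grid ltrBlDr ltrDl expR_gt0. Qed.

Lemma grid_le h i j : 0 <= h -> (i <= j)%N -> grid h i <= grid h j.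
Proof.
by move=> h0 ij; rewrite lerD2l lerN2 ler_expR lerN2 ler_wpM2r// ler_nat.
Qed.

Lemma grid_lt h i j : 0 < h -> (i < j)%N -> grid h i < grid h j.
Proof.
by move=> h0 ij; rewrite ltrD2l ltrN2 ltr_expR ltrN2 ltr_pM2r// ltr_nat.
Qed.

Lemma grid_ge0 h i : 0 <= h -> 0 <= grid h i.
Proof. by move=> h0; rewrite -(grid0 h); exact: grid_le. Qed.

Lemma one_sub_grid_inv h i : (1 - grid h i)^-1 = expR h ^+ i.
Proof. by rewrite /grid opprB addrC subrK expRN invrK expRM_natl. Qed.

Lemma gridS_sub h i : 0 <= h -> grid h i.+1 - grid h i <= h.
Proof.
move=> h0; rewrite /grid.
have -> : 1 - expR (- (i.+1%:R * h)) - (1 - expR (- (i%:R * h))) =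
    expR (- (i%:R * h)) * (1 - expR (- h)).
  by rewrite -natr1 mulrDl mul1r opprD expRD; ring.
rewrite -[leRHS]mul1r ler_pM ?expR_ge0//.
- by rewrite subr_ge0 -expR0 ler_expR oppr_le0.
- by rewrite -expR0 ler_expR oppr_le0 mulr_ge0.
- by rewrite lerBlDr addrC -lerBlDr; exact: expR_ge1Dx.
Qed.

Variables (L T : R).
Hypotheses (L0 : 0 < L) (TE : T = 1 - expR (- L)).

Definition step (n : nat) : R := L / n.+1%:R.

Lemma step_gt0 n : 0 < step n. Proof. by rewrite divr_gt0. Qed.

Lemma step_ge0 n : 0 <= step n. Proof. exact/ltW/step_gt0. Qed.

Lemma step_cvg : step @ \oo --> 0.
Proof.
by rewrite -(mulr0 L); apply: cvgM; [exact: cvg_cst|exact: cvg_harmonic].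
Qed.

Lemma mul_step n : n.+1%:R * step n = L.
Proof. by rewrite mulrC divfK. Qed.

Lemma grid_last n : grid (step n) n.+1 = T.
Proof. by rewrite TE /grid mul_step. Qed.

Lemma grid_le_last n i : (i <= n.+1)%N -> grid (step n) i <= T.
Proof. by move=> ni; rewrite -(grid_last n) grid_le// step_ge0. Qed.

Lemma grid_osc (f : R -> R) (e : R) : {within `[0, T], continuous f} -> 0 < e ->
  \forall n \near \oo, forall i, (i < n.+1)%N -> forall s t,
    s \in `[grid (step n) i, grid (step n) i.+1] ->
    t \in `[grid (step n) i, grid (step n) i.+1] -> `|f s - f t| <= e.
Proof.
move=> cf e0; have [delta d0 fd] := segment_unif_continuous cf e0.
near=> n => i ni s t sg tg.
have sub u : u \in `[grid (step n) i, grid (step n) i.+1] -> u \in `[0, T].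
  rewrite !in_itv/= => /andP[iu ui]; rewrite (le_trans _ iu) ?grid_ge0 ?step_ge0//=.
  by rewrite (le_trans ui)// grid_le_last.
apply: fd; [exact: sub|exact: sub|].
apply: (@le_lt_trans _ _ (step n)).
  apply: le_trans (gridS_sub i (step_ge0 n)).
  move: sg tg; rewrite !in_itv/= => /andP[s1 s2] /andP[t1 t2].
  by rewrite ler_norml; apply/andP; split; lra.
by near: n; apply: (cvgr_lt (0 : R)) => //; exact: step_cvg.
Unshelve. all: by end_near. Qed.

(** The flag b selects the right endpoints instead of the left ones. *)
Lemma log_weight_riemann (f : R -> R) (b : bool) :
  {within `[0, T], continuous f} ->
  \sum_(i < n.+1) step n * f (grid (step n) (i + b)%N) @[n --> \oo] -->
  \int[mu]_(s in `[0, T]) (f s / (1 - s)).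
Proof.
move=> cf; apply/cvgrPdist_le => e e0.
have eL0 : 0 < e / L by rewrite divr_gt0.
pose F t := \int[mu]_(s in `[0, t]) (f s / (1 - s)).
have F0 : F 0 = 0 by rewrite /F set_itv1 Rintegral_set1.
near=> n.
have osc : forall i, (i < n.+1)%N -> forall s t,
    s \in `[grid (step n) i, grid (step n) i.+1] ->
    t \in `[grid (step n) i, grid (step n) i.+1] -> `|f s - f t| <= e / L.
  by near: n; exact: grid_osc.
rewrite -/(F T).
have -> : F T = \sum_(i < n.+1) (F (grid (step n) i.+1) - F (grid (step n) i)).
  rewrite -(big_mkord xpredT (fun i => F (grid (step n) i.+1) - F (grid (step n) i))).
  by rewrite telescope_sumr// grid_last grid0 F0 subr0.
rewrite -sumrB (le_trans (ler_norm_sum _ _ _))//.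
have -> : e = \sum_(i < n.+1) (e / L * step n).
  rewrite sumr_const card_ord -mulr_natl mulrCA mul_step divfK//.
  by rewrite gt_eqF.
apply: ler_sum => i _.
have hE : step n = ln (1 - grid (step n) i) - ln (1 - grid (step n) i.+1).
  by rewrite !ln_one_sub_grid -[in RHS]natr1; ring.
have ile := grid_le (step_ge0 n) (leqnSn i).
rewrite [step n * _]mulrC.
have := @log_weight_increment f (grid (step n) i) (grid (step n) i.+1)
  (f (grid (step n) (i + b)%N)) (e / L); rewrite -hE; apply => //.
- by rewrite grid_ge0 ?step_ge0.
- exact: grid_lt1.
- apply: (continuous_subspaceW _ cf); apply: subset_itvl.
  by rewrite bnd_simp grid_le_last.
- move=> s sg; apply: (osc i) => //.
  by case: b; rewrite ?addn1 ?addn0 in_itv/= lexx ?andbT.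
Unshelve. all: by end_near. Qed.

End log_weight.

(** * Pathwise approximation of the bridge *)

Section path_approximation.
Context {R : realType}.
Notation mu := (@lebesgue_measure R).
Variables (L T alpha : R) (w x : R -> R).
Hypotheses (L0 : 0 < L) (TE : T = 1 - expR (- L)) (alpha0 : 0 <= alpha).
Hypothesis x0 : x 0 = 0.
Hypothesis cx1 : {within `[0, 1[, continuous x}.
Hypothesis xE : forall t, 0 <= t < 1 ->
  x t = w t - \int[mu]_(s in `[0, t]) (alpha / (1 - s) * x s).

Let T1 : T < 1. Proof. by rewrite TE ltrBlDr ltrDl expR_gt0. Qed.

Let T0 : 0 < T. Proof. by rewrite TE subr_gt0 expR_lt1 oppr_lt0. Qed.

Let cx : {within `[0, T], continuous x}.
Proof. by apply: (continuous_subspaceW _ cx1); apply: subset_itvl; rewrite bnd_simp. Qed.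

Let h := step L.
Let g n i := grid (h n) i.
Let dw n i := w (g n i.+1) - w (g n i).

Let h0 n : 0 < h n. Proof. exact: step_gt0. Qed.

Let g_ge0 n i : 0 <= g n i. Proof. by rewrite grid_ge0// ltW. Qed.

Let g_leT n i : (i <= n.+1)%N -> g n i <= T.
Proof. exact: grid_le_last. Qed.

Let g_in n i : (i <= n.+1)%N -> g n i \in `[0, T].
Proof. by move=> ni; rewrite in_itv/= g_ge0 g_leT. Qed.

Let drift n i := dw n i - (x (g n i.+1) - x (g n i)).

(** The drift over a cell is the integral of alpha x / (1 - s), by the
    equation of the bridge. *)
Lemma drift_increment n i c e : (i < n.+1)%N ->
  (forall s, s \in `[g n i, g n i.+1] -> `|alpha * x s - c| <= e) ->
  `|drift n i - c * h n| <= e * h n.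
Proof.
move=> ni fe.
have hE : h n = ln (1 - g n i) - ln (1 - g n i.+1).
  by rewrite !ln_one_sub_grid -[in RHS]natr1; ring.
have xgE j : x (g n j) = w (g n j) - \int[mu]_(s in `[0, g n j]) (alpha * x s / (1 - s)).
  rewrite xE ?g_ge0 ?grid_lt1//; congr (_ - _).
  by apply: eq_Rintegral => s _; rewrite mulrAC.
rewrite /drift /dw !xgE.
have -> (a b I J : R) : a - b - (a - I - (b - J)) = I - J by ring.
rewrite hE; apply: (@log_weight_increment _ (fun s => alpha * x s)) => //.
- by rewrite grid_le// ltW.
- exact: grid_lt1.
- move=> s; apply: cvgM; first exact: cvg_cst.
  apply: (continuous_subspaceW _ cx); apply: subset_itvl.
  by rewrite bnd_simp; exact: g_leT.
Qed.

Lemma path_bounded : exists2 M, 0 <= M & forall s, s \in `[0, T] -> `|x s| <= M.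
Proof.
have [c _ cM] : exists2 c, c \in `[0, T] & forall t, t \in `[0, T] -> `|x t| <= `|x c|.
  apply: (@EVT_max _ (fun s => `|x s|)); first exact: ltW.
  by move=> s; apply: cvg_norm; exact: cx.
by exists `|x c|.
Qed.

Lemma drift_bound M n i : (i < n.+1)%N ->
  (forall s, s \in `[0, T] -> `|x s| <= M) -> `|drift n i| <= alpha * M * h n.
Proof.
move=> ni xM; rewrite -[drift n i]subr0 -(mul0r (h n)).
apply: drift_increment => // s; rewrite in_itv/= => /andP[s1 s2].
rewrite subr0 normrM ger0_norm// ler_wpM2l// xM// in_itv/=.
by rewrite (le_trans _ s1) ?g_ge0//= (le_trans s2)// g_leT.
Qed.

(** Since w increases by the increment of x plus the drift, the error is (1 -
    a (1 + y)) x at the right endpoint minus a times the deviation of the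
    drift from y x, where y = alpha h; and 0 <= 1 - a (1 + y) <= y^2. *)
Lemma scheme_error_step a M n i e : (i < n.+1)%N ->
  a = expR (- (alpha * h n)) ->
  (forall s, s \in `[0, T] -> `|x s| <= M) ->
  `|drift n i - alpha * x (g n i.+1) * h n| <= e * h n ->
  `|x (g n i.+1) - a * (x (g n i) + dw n i)| <=
    (alpha * h n) ^+ 2 * M + e * h n.
Proof.
move=> ni aE xM de; set y := alpha * h n.
have y0 : 0 <= y by rewrite mulr_ge0// ltW.
have a_ge0 : 0 <= a by rewrite aE expR_ge0.
have a1 : a <= 1 by rewrite aE -expR0 ler_expR oppr_le0.
have y1 : 0 < 1 + y by rewrite ltr_wpDr.
have ay1 : a * (1 + y) <= 1.
  rewrite -ler_pdivlMr// mul1r aE expRN lef_pV2 ?posrE ?expR_gt0//.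
  exact: expR_ge1Dx.
have ay2 : 1 - y ^+ 2 <= a * (1 + y).
  have -> : 1 - y ^+ 2 = (1 - y) * (1 + y) by ring.
  rewrite ler_wpM2r ?(ltW y1)//.
  by rewrite aE; exact: expR_ge1Dx.
have -> : x (g n i.+1) - a * (x (g n i) + dw n i) =
    (1 - a * (1 + y)) * x (g n i.+1) -
    a * (drift n i - alpha * x (g n i.+1) * h n).
  by rewrite /drift /y; ring.
rewrite (le_trans (ler_normB _ _))// lerD//.
  rewrite normrM ler_pM//; last by apply: xM; exact: g_in.
  by rewrite ger0_norm ?subr_ge0// lerBlDr -lerBlDl.
by rewrite normrM ger0_norm// (le_trans _ de)// ler_piMl.
Qed.

(** As the decay factor is at most 1, one-step errors are not amplified; n + 1
    of them, each O(h^2) + e h, add up to O(h) + O(e). *)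
Lemma scheme_cvg (e : R) : 0 < e ->
  \forall n \near \oo, forall i, (i <= n.+1)%N ->
  `|x (g n i) - scheme (expR (- (alpha * h n))) (dw n) i| <= e.
Proof.
move=> e0; have [M M0 xM] := path_bounded.
have e1 : 0 < e / 2 / L by rewrite !divr_gt0.
have cax : {within `[0, T], continuous (fun s => alpha * x s)}.
  by move=> s; apply: cvgM; [exact: cvg_cst|exact: cx].
have hM : (alpha ^+ 2 * M * L) * h n @[n --> \oo] --> 0.
  rewrite -(mulr0 (alpha ^+ 2 * M * L)).
  by apply: cvgM; [exact: cvg_cst|exact: step_cvg].
near=> n.
have osc : forall i, (i < n.+1)%N -> forall s t,
    s \in `[g n i, g n i.+1] -> t \in `[g n i, g n i.+1] ->
    `|alpha * x s - alpha * x t| <= e / 2 / L.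
  by near: n; exact: (grid_osc L0 TE cax e1).
have hMn : (alpha ^+ 2 * M * L) * h n <= e / 2.
  by near: n; apply: (cvgr_le (0 : R)) => //; rewrite divr_gt0.
set a := expR _; pose E := (alpha * h n) ^+ 2 * M + e / 2 / L * h n.
have E0 : 0 <= E.
  by rewrite /E addr_ge0// mulr_ge0 ?sqr_ge0// ltW.
have err i : (i <= n.+1)%N -> `|x (g n i) - scheme a (dw n) i| <= i%:R * E.
  elim: i => [_|i IH ni]; first by rewrite /= /g grid0 x0 subr0 normr0 mul0r.
  have := @scheme_error_step a M n i (e / 2 / L) ni erefl xM.
  have /[swap] /[apply] : `|drift n i - alpha * x (g n i.+1) * h n| <= e / 2 / L * h n.
    apply: drift_increment => // s sg; apply: (osc i) => //.
    by rewrite in_itv/= lexx andbT grid_le// ltW.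
  rewrite -/E => le1.
  have -> : x (g n i.+1) - scheme a (dw n) i.+1 =
     (x (g n i.+1) - a * (x (g n i) + dw n i)) +
     a * (x (g n i) - scheme a (dw n) i) by rewrite /=; ring.
  rewrite (le_trans (ler_normD _ _))// -natr1 mulrDl mul1r addrC lerD//.
  rewrite normrM ger0_norm ?expR_ge0// (le_trans _ (IH (ltnW ni)))//.
  by rewrite ler_piMl// -expR0 ler_expR oppr_le0 mulr_ge0// ltW.
move=> i ni; rewrite (le_trans (err i ni))//.
apply: (@le_trans _ _ (n.+1%:R * E)); first by rewrite ler_wpM2r// ler_nat.
have -> : n.+1%:R * E = alpha ^+ 2 * M * (n.+1%:R * h n) * h n +
   e / 2 / L * (n.+1%:R * h n) by rewrite /E; ring.
by rewrite mul_step divfK ?gt_eqF// [leRHS]splitr lerD.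
Unshelve. all: by end_near. Qed.

Let energy := \int[mu]_(s in `[0, T]) (x s ^+ 2 / (1 - s) ^+ 2).

Let cx2 : {within `[0, T], continuous (fun s => x s ^+ 2 / (1 - s))}.
Proof.
move=> s; apply: cvgM; first by apply: cvgM; exact: cx.
exact: continuous_onem_inv.
Qed.

Let energyE : energy = \int[mu]_(s in `[0, T]) (x s ^+ 2 / (1 - s) / (1 - s)).
Proof.
by apply: eq_Rintegral => s _; rewrite -[RHS]mulrA -invfM -expr2.
Qed.

Let expR_step_le n i : (i <= n.+1)%N -> expR (h n) ^+ i <= expR L.
Proof.
by move=> ni; rewrite -expRM_natl ler_expR -[leRHS](mul_step L n) ler_wpM2r ?ler_nat// ltW.
Qed.

Lemma energy_riemann (b : bool) :
  \sum_(i < n.+1) h n * (expR (h n) ^+ (i + b) * x (g n (i + b)%N) ^+ 2)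
    @[n --> \oo] --> energy.
Proof.
rewrite energyE.
under eq_cvg => n.
  under eq_bigr do rewrite -one_sub_grid_inv mulrC [_^-1 * _]mulrC mulrC.
  over.
exact: (log_weight_riemann L0 TE b cx2).
Qed.

Lemma scheme_energy_cvg :
  \sum_(i < n.+1) h n * (expR (h n) ^+ i *
     scheme (expR (- (alpha * h n))) (dw n) i ^+ 2) @[n --> \oo] --> energy.
Proof.
pose X n i := scheme (expR (- (alpha * h n))) (dw n) i.
pose D n := \sum_(i < n.+1) h n * (expR (h n) ^+ i *
    (X n i ^+ 2 - x (g n i) ^+ 2)).
have cx0 := energy_riemann false.
suff cD : D n @[n --> \oo] --> 0.
  rewrite -[energy]addr0; under eq_cvg => n.
    rewrite (_ : bigop _ _ _ = \sum_(i < n.+1) h n *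
      (expR (h n) ^+ (i + false) * x (g n (i + false)%N) ^+ 2) + D n); last first.
      rewrite /D -big_split/=; apply: eq_bigr => i _.
      by rewrite addn0 -/(X n i); ring.
    over.
  exact: cvgD.
apply/cvgr0Pnorm_le => e e0.
have [M M0 xM] := path_bounded.
(* Z^2 - Y^2 = (Z - Y) ((Z - Y) + 2 Y) with |Z - Y| <= d <= 1 and |Y| <= M. *)
pose C := L * expR L * (M *+ 2 + 1).
have C0 : 0 < C by rewrite !mulr_gt0 ?expR_gt0// ltr_wpDl// mulrn_wge0.
pose d := Num.min 1 (e / C).
have d0 : 0 < d by rewrite lt_min ltr01 divr_gt0.
near=> n.
have err : forall i, (i <= n.+1)%N ->
    `|x (g n i) - scheme (expR (- (alpha * h n))) (dw n) i| <= d.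
  by near: n; exact: scheme_cvg.
rewrite (le_trans (ler_norm_sum _ _ _))//.
apply: (@le_trans _ _ (\sum_(i < n.+1) h n * (expR L * (d * (M *+ 2 + 1))))).
  apply: ler_sum => i _; have in1 : (i <= n.+1)%N by exact: ltnW.
  rewrite normrM ger0_norm ?(ltW (h0 n))// ler_wpM2l ?(ltW (h0 n))//.
  rewrite normrM ger0_norm ?exprn_ge0 ?expR_ge0//.
  rewrite ler_pM ?exprn_ge0 ?expR_ge0 ?expR_step_le//.
  move: (err i in1) (xM _ (g_in in1)).
  rewrite -/(X n i); set Z := X n i; set Y := x _ => XY YM.
  have d1 : d <= 1 by rewrite ge_min lexx.
  have -> : Z ^+ 2 - Y ^+ 2 = (Z - Y) * ((Z - Y) + Y *+ 2) by rewrite mulr2n; ring.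
  rewrite normrM ler_pM//; first by rewrite distrC.
  rewrite (le_trans (ler_normD _ _))// addrC lerD// ?normrMn ?lerMn2r ?YM ?orbT//.
  by rewrite distrC (le_trans XY).
rewrite sumr_const card_ord -mulr_natl mulrA mul_step.
have -> : L * (expR L * (d * (M *+ 2 + 1))) = d * C by rewrite /C; ring.
by rewrite -ler_pdivlMr// ge_min lexx orbT.
Unshelve. all: by end_near. Qed.

Lemma scheme_terminal_cvg :
  expR (h n) ^+ n.+1 * scheme (expR (- (alpha * h n))) (dw n) n.+1 ^+ 2
    @[n --> \oo] --> x T ^+ 2 / (1 - T).
Proof.
have -> : (1 - T)^-1 = expR L by rewrite TE opprB addrC subrK expRN invrK.
rewrite mulrC; under eq_cvg do rewrite -expRM_natl mul_step.
apply: cvgM; first exact: cvg_cst.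
apply: (@cvg_comp _ _ _ _ (fun y : R => y ^+ 2)); last exact: sqr_continuous.
apply/cvgrPdist_le => e e0; near=> n.
rewrite -(grid_last TE n).
by near: n; have := scheme_cvg e0; apply: filterS => n; exact.
Unshelve. all: by end_near. Qed.

(** Summation by parts: 2 x_i (x_(i+1) - x_i) is the increment of x^2 minus
    the squared increment of x. The weights 1 / (1 - t_i) turn the first part
    into the terminal square minus a Riemann sum, and the squared increments
    of x and of w differ by terms that contain the drift as a factor. *)
Lemma left_sum_cvg :
  \sum_(i < n.+1) x (g n i) / (1 - g n i) * (x (g n i.+1) - x (g n i)) +
  2^-1 * \sum_(i < n.+1) expR (h n) ^+ i * dw n i ^+ 2 @[n --> \oo] -->
  2^-1 * (x T ^+ 2 / (1 - T) - energy).
Proof.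
pose tau n := (1 - expR (- (1 * h n))) / h n.
have ctau : tau n @[n --> \oo] --> (1 : R).
  by apply: one_sub_expR_slope_cvg => //; exact: step_cvg.
pose rsum n := \sum_(i < n.+1) h n * (expR (h n) ^+ i.+1 * x (g n i.+1) ^+ 2).
have crsum : rsum n @[n --> \oo] --> energy.
  have := energy_riemann true.
  by under eq_cvg do under eq_bigr do rewrite addn1.
pose cross n := \sum_(i < n.+1) expR (h n) ^+ i *
  (drift n i * ((x (g n i.+1) - x (g n i)) *+ 2 + drift n i)).
have ccross : cross n @[n --> \oo] --> 0.
  have [M M0 xM] := path_bounded.
  pose C := expR L * (alpha * M * L * (2 + alpha * M)).
  have C0 : 0 <= C by rewrite !mulr_ge0 ?expR_ge0 ?addr_ge0 ?mulr_ge0// ltW.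
  apply/cvgr0Pnorm_le => e e0.
  pose d := e / (C + 1).
  have d0 : 0 < d by rewrite divr_gt0// ltr_wpDl.
  near=> n.
  have osc : forall i, (i < n.+1)%N -> forall s t,
      s \in `[g n i, g n i.+1] -> t \in `[g n i, g n i.+1] -> `|x s - x t| <= d.
    by near: n; exact: (grid_osc L0 TE cx d0).
  have hd : h n <= d by near: n; apply: (cvgr_le (0 : R)) => //; exact: step_cvg.
  apply: (@le_trans _ _ (d * C)); last first.
    rewrite /d mulrAC ler_pdivrMr ?ltr_wpDl// ler_wpM2l ?(ltW e0)//.
    by rewrite lerDl.
  rewrite (le_trans (ler_norm_sum _ _ _))//.
  apply: (@le_trans _ _ (\sum_(i < n.+1)
      expR L * (alpha * M * h n * (d * (2 + alpha * M))))); last first.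
    rewrite sumr_const card_ord -[leLHS]mulr_natl.
    have -> (N e1 K D hn : R) : N * (e1 * (alpha * M * hn * (D * K))) =
        D * (e1 * (alpha * M * (N * hn) * K)) by ring.
    by rewrite mul_step.
  apply: ler_sum => i _; have in1 : (i <= n.+1)%N by exact: ltnW.
  have ile : g n i <= g n i.+1 by rewrite grid_le// ltW.
  rewrite normrM ger0_norm ?exprn_ge0 ?expR_ge0//.
  rewrite ler_pM ?exprn_ge0 ?expR_ge0 ?expR_step_le//.
  have di := drift_bound (ltn_ord i) xM.
  rewrite normrM ler_pM// (le_trans (ler_normD _ _))// mulrDr lerD//.
    rewrite normrMn -[leLHS]mulr_natr ler_wpM2r//; apply: (osc i) => //.
      by rewrite in_itv/= ile lexx.
    by rewrite in_itv/= lexx ile.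
  by rewrite (le_trans di)// mulrC ler_wpM2r// mulr_ge0.
have -> : (fun n => \sum_(i < n.+1) x (g n i) / (1 - g n i) * (x (g n i.+1) - x (g n i)) +
  2^-1 * \sum_(i < n.+1) expR (h n) ^+ i * dw n i ^+ 2) =
  (fun n => 2^-1 * (x T ^+ 2 / (1 - T) - tau n * rsum n + cross n)).
  apply/funext => n.
  have tel : x T ^+ 2 / (1 - T) = \sum_(i < n.+1)
    (expR (h n) ^+ i.+1 * x (g n i.+1) ^+ 2 - expR (h n) ^+ i * x (g n i) ^+ 2).
    rewrite -(big_mkord xpredT (fun i => expR (h n) ^+ i.+1 * x (g n i.+1) ^+ 2
      - expR (h n) ^+ i * x (g n i) ^+ 2)).
    rewrite telescope_sumr// -(grid_last TE n) -one_sub_grid_inv mulrC.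
    by rewrite [x (g n 0)](_ : _ = 0) ?expr0n ?mulr0 ?subr0// /g grid0.
  rewrite tel /cross /rsum [tau n * _]mulr_sumr -sumrB -big_split/=.
  rewrite !mulr_sumr -big_split/=; apply: eq_bigr => i _.
  have dwE : dw n i = drift n i + (x (g n i.+1) - x (g n i)).
    by rewrite /drift; ring.
  rewrite one_sub_grid_inv /tau mul1r expRN dwE [_ ^+ i.+1]exprS; field.
  by rewrite gt_eqF//= gt_eqF ?expR_gt0.
apply: cvgM; first exact: cvg_cst.
rewrite -[X in _ --> X]addr0; apply: cvgD => //.
apply: cvgB; first exact: cvg_cst.
by rewrite -[energy]mul1r; exact: cvgM.
Unshelve. all: by end_near. Qed.

End path_approximation.

(** * Convergence in probability *)

Section convergence_in_probability.
Context d (T : measurableType d) (R : realType) (P : probability T R).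

Lemma bounded_convergence (f_ : nat -> T -> R) (f : T -> R) (M : R) :
  (forall n, measurable_fun setT (f_ n)) -> measurable_fun setT f ->
  {ae P, forall w, f_ n w @[n --> \oo] --> f w} ->
  (forall n w, `|f_ n w| <= M) ->
  (\int[P]_w (f_ n w)%:E)%E @[n --> \oo] --> (\int[P]_w (f w)%:E)%E.
Proof.
move=> mf_ mf ff fM.
have [//|//||||_ _] := @dominated_convergence _ T R P setT measurableT
  (fun n => EFin \o f_ n) (EFin \o f) (cst M%:E).
- by move=> n; exact/measurable_EFinP.
- exact/measurable_EFinP.
- apply: filterS ff => w fw _; apply: cvg_EFin; first exact: nearW.
  exact: fw.
- exact: finite_measure_integrable_cst.
- by apply: nearW => w n _; rewrite lee_fin.
- exact.
Qed.

Definition cvg0_in_prob (U : nat -> T -> R) :=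
  forall e eta : R, 0 < e -> 0 < eta ->
    \forall n \near \oo, (P [set w | (e <= `|U n w|)%R] <= eta%:E)%E.

Lemma measurable_ge_norm (U : T -> R) e : measurable_fun setT U ->
  measurable [set w | e <= `|U w|].
Proof.
move=> mU; rewrite (_ : mkset _ = (fun w => `|U w|) @^-1` `[e, +oo[); last first.
  by apply/seteqP; split=> w /=; rewrite in_itv/= andbT.
by rewrite -[X in measurable X]setTI; apply: measurableT_comp.
Qed.

(** Bounded convergence for the indicators of the events. *)
Lemma cvg0_in_prob_ae (U : nat -> T -> R) :
  (forall n, measurable_fun setT (U n)) ->
  {ae P, forall w, U n w @[n --> \oo] --> 0} -> cvg0_in_prob U.
Proof.
move=> mU U0 e eta e0 eta0.
pose E n := [set w | e <= `|U n w|].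
have mE n : measurable (E n) by exact: measurable_ge_norm.
have mI n : measurable_fun setT (\1_(E n) : T -> R) by exact: measurable_indic.
have I0 : {ae P, forall w, (\1_(E n) w : R) @[n --> \oo] --> (0 : R)}.
  apply: filterS U0 => w /cvgr0Pnorm_lt/(_ _ e0) Uw.
  apply: cvg_near_cst; near=> n => /=.
  rewrite indicE memNset// /E/= => eU.
  have : `|U n w| < e by near: n.
  by rewrite ltNge eU.
have H : (\int[P]_w (\1_(E n) w)%:E)%E @[n --> \oo] --> (\int[P]_w (cst 0 w)%:E)%E.
  apply: (@bounded_convergence _ _ 1) => // n w.
  by rewrite indicE; case: (_ \in _); rewrite ?normr1 ?normr0.
move: H; rewrite integral0 => H.
have /fine_cvgP[_ ] := H.
move=> /cvgr_le/(_ _ eta0) => H'.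
near=> n.
have : fine (\int[P]_w (\1_(E n) w)%:E)%E <= eta by near: n.
rewrite integral_indic// setIT => Pn.
rewrite -[P _]fineK; last by rewrite fin_num_measure//; exact: mE.
by rewrite lee_fin.
Unshelve. all: by end_near. Qed.

Lemma cvg0_in_probD (U V : nat -> T -> R) :
  (forall n, measurable_fun setT (U n)) ->
  (forall n, measurable_fun setT (V n)) ->
  cvg0_in_prob U -> cvg0_in_prob V -> cvg0_in_prob (fun n w => U n w + V n w).
Proof.
move=> mU mV cU cV e eta e0 eta0.
have e20 : 0 < e / 2 by rewrite divr_gt0.
have eta20 : 0 < eta / 2 by rewrite divr_gt0.
near=> n.
have Un : (P [set w | (e / 2 <= `|U n w|)%R] <= (eta / 2)%:E)%E by near: n; exact: cU.
have Vn : (P [set w | (e / 2 <= `|V n w|)%R] <= (eta / 2)%:E)%E by near: n; exact: cV.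
apply: (@le_trans _ _ (P ([set w | e / 2 <= `|U n w|] `|` [set w | e / 2 <= `|V n w|]))).
  apply: le_measure; rewrite ?inE.
  - by apply: measurable_ge_norm; exact: measurable_funD.
  - by apply: measurableU; exact: measurable_ge_norm.
  - move=> w /= eUV; have [?|Uw] := leP (e / 2) `|U n w|; first by left.
    right; have := le_trans eUV (ler_normD _ _); rewrite [in X in X -> _](splitr e).
    by move: Uw; lra.
apply: (@le_trans _ _ (P [set w | (e / 2 <= `|U n w|)%R] +
    P [set w | (e / 2 <= `|V n w|)%R])%E).
  by apply: measureU2; exact: measurable_ge_norm.
by rewrite [in leRHS](splitr eta) EFinD leeD.
Unshelve. all: by end_near. Qed.

Lemma cvg0_in_prob_dom (U V : nat -> T -> R) :
  (forall n, measurable_fun setT (U n)) ->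
  (forall n, measurable_fun setT (V n)) ->
  (forall e, 0 < e -> exists2 delta, 0 < delta &
     forall n w, e <= `|U n w| -> delta <= `|V n w|) ->
  cvg0_in_prob V -> cvg0_in_prob U.
Proof.
move=> mU mV UV cV e eta e0 eta0; have [delta delta0 eUV] := UV _ e0.
apply: filterS (cV _ _ delta0 eta0) => n; apply: le_trans.
apply: le_measure; rewrite ?inE; [exact: measurable_ge_norm..|].
by move=> w; exact: eUV.
Qed.

Lemma cvg0_in_prob_cst (U : T -> R) : measurable_fun setT U ->
  cvg0_in_prob (fun=> U) -> {ae P, forall w, U w = 0}.
Proof.
move=> mU cU.
pose E (k : nat) := [set w | k.+1%:R^-1 <= `|U w|].
have mE k : measurable (E k) by exact: measurable_ge_norm.
have E0 k : P (E k) = 0%E.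
  apply/eqP; rewrite -measure_le0; apply/lee_addgt0Pr => eta eta0.
  rewrite add0e.
  have k0 : 0 < (k.+1%:R^-1 : R) by rewrite invr_gt0.
  by have [N _ /(_ N (leqnn N))] := cU _ _ k0 eta0.
have : P.-negligible (\bigcup_k E k).
  apply: negligible_bigcup => k.
  by exists (E k); split => //; exact: E0.
apply: negligibleS => w /= Uw; have Uw0 : 0 < `|U w| by rewrite normr_gt0; apply/eqP.
exists (Num.trunc `|U w|^-1) => //=.
rewrite /E/= -[leRHS]invrK lef_pV2 ?posrE ?invr_gt0// ltW//.
exact: truncnS_gt.
Qed.

Lemma cvg0_in_prob_sqr (U : nat -> T -> R) :
  (forall n, measurable_fun setT (U n)) ->
  (\int[P]_w (U n w ^+ 2)%:E)%E @[n --> \oo] --> 0%E -> cvg0_in_prob U.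
Proof.
move=> mU cU e eta e0 eta0.
have e2 : 0 < e ^+ 2 * eta by rewrite mulr_gt0// exprn_gt0.
have /fine_cvgP[fU /cvgr_le/(_ _ e2) lU] := cU.
near=> n.
have nU : (\int[P]_w (U n w ^+ 2)%:E)%E \is a fin_num by near: n.
have leU : fine (\int[P]_w (U n w ^+ 2)%:E)%E <= e ^+ 2 * eta by near: n.
have mEn : measurable [set w | e <= `|U n w|] by exact: measurable_ge_norm.
rewrite -(@lee_pmul2l _ (e ^+ 2)%:E)//; last by rewrite lte_fin exprn_gt0.
rewrite -EFinM; apply: (@le_trans _ _ (\int[P]_w (U n w ^+ 2)%:E)%E); last first.
  by rewrite -[leLHS]fineK// lee_fin.
rewrite -integral_cst//.
rewrite [leLHS]integral_mkcond; apply: ge0_le_integral => //.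
- move=> w _; rewrite patchE; case: ifP => // _.
  by rewrite lee_fin exprn_ge0// ltW.
- by apply/(measurable_restrictT _ _).1.
- by apply/measurable_EFinP; exact: measurable_funX.
- move=> w _; rewrite patchE; case: ifPn => [|_]; last by rewrite lee_fin sqr_ge0.
  rewrite inE/= => eU; rewrite lee_fin -(real_normK (num_real (U n w))).
  by rewrite ler_sqr ?nnegrE// ltW.
Unshelve. all: by end_near. Qed.

End convergence_in_probability.

(** * Quadratic variation of Brownian motion *)

Section brownian_grid.
Context d (Omega : measurableType d) (R : realType) (P : probability Omega R).
Variable W : R -> {RV P >-> R}.
Hypothesis hW : brownian_motion W.

Definition grid_increment (h : R) (i : nat) (w : Omega) : R :=
  W (grid h i.+1) w - W (grid h i) w.

Definition grid_sd (h : R) (i : nat) : R := Num.sqrt (grid h i.+1 - grid h i).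

Lemma grid_increment_measurable (h : R) i : measurable_fun setT (grid_increment h i).
Proof. exact: measurable_funB. Qed.

Lemma gridS_subE (h : R) i :
  grid h i.+1 - grid h i = expR (- h) ^+ i * (1 - expR (- h)).
Proof.
rewrite /grid -expRM_natl mulrN -[in LHS]natr1 mulrDl mul1r opprD expRD; ring.
Qed.

Lemma grid_sd_sqr (h : R) i : 0 <= h ->
  expR h ^+ i * grid_sd h i ^+ 2 = 1 - expR (- h).
Proof.
move=> h0; rewrite sqr_sqrtr ?subr_ge0 ?grid_le// gridS_subE mulrA -exprMn.
by rewrite expRN divff ?expr1n ?mul1r// gt_eqF// expR_gt0.
Qed.

Lemma grid_sd_neq0 (h : R) i : 0 < h -> grid_sd h i != 0.
Proof.
move=> h0; rewrite sqrtr_eq0 -ltNge gridS_subE mulr_gt0 ?exprn_gt0 ?expR_gt0//.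
by rewrite subr_gt0 expR_lt1 oppr_lt0.
Qed.

Lemma grid_increment_law h i (B : set R) : 0 < h -> measurable B ->
  P (grid_increment h i @^-1` B) = normal_prob 0 (grid_sd h i) B.
Proof.
case: hW => _ law _ _ h0 mB; apply: law => //.
- exact/grid_ge0/ltW.
- by rewrite -subr_gt0 -sqrtr_gt0 lt_neqAle eq_sym grid_sd_neq0//= sqrtr_ge0.
- exact/ltW/grid_lt1.
Qed.

Lemma grid_increment_indep h k : 0 < h ->
  mutually_independent P (fun i : 'I_k.+1 => grid_increment h i).
Proof.
case: hW => _ _ ind _ h0; apply: (ind _ (grid h)).
- exact/grid_ge0/ltW.
- by move=> i _; apply: grid_le => //; exact: ltW.
- exact/ltW/grid_lt1.
Qed.

Variable L : R.
Hypothesis L0 : 0 < L.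
Let h := step L.
Let h0 n : 0 < h n. Proof. exact: step_gt0. Qed.

Definition quadratic_sum (n : nat) (w : Omega) : R :=
  \sum_(i < n.+1) expR (h n) ^+ i * grid_increment (h n) i w ^+ 2.

Lemma quadratic_sum_measurable n : measurable_fun setT (quadratic_sum n).
Proof.
apply: measurable_sum => i; apply: measurable_funM => //.
by apply: measurable_funX; exact: grid_increment_measurable.
Qed.

Lemma quadratic_sum_laplace a n : 0 <= a ->
  (\int[P]_w (expR (- (a * quadratic_sum n w)))%:E =
   ((Num.sqrt (1 + 2 * a * (1 - expR (- h n))))^-1 ^+ n.+1)%:E)%E.
Proof.
move=> a0; apply: (squares_laplace (grid_increment_measurable (h n))
  (s := grid_sd (h n)) _ _ _ (b := fun i => expR (h n) ^+ i)) => //.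
- by move=> k; exact: grid_increment_indep.
- by move=> k; exact: grid_sd_neq0.
- by move=> k B; exact: grid_increment_law.
- by move=> i; apply: grid_sd_sqr; exact: ltW.
Qed.

(** Squeeze: exp (y / (1 + y)) <= 1 + y <= exp y, with n y tending to 2 a L.
    *)
Lemma inv_sqrt_one_add_cvg a : 0 <= a ->
  (Num.sqrt (1 + 2 * a * (1 - expR (- h n))))^-1 ^+ n.+1 @[n --> \oo] -->
  expR (- (a * L)).
Proof.
move=> a0.
pose t n := 1 - expR (- h n).
have t0 n : 0 < t n by rewrite subr_gt0 expR_lt1 oppr_lt0.
pose y n := 2 * a * t n.
have y0 n : 0 <= y n by rewrite mulr_ge0 ?mulr_ge0// ltW.
have ct : n.+1%:R * t n @[n --> \oo] --> L.
  have -> : (fun n => n.+1%:R * t n) = (fun n => L * ((1 - expR (- (1 * h n))) / h n)).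
    apply/funext => n; rewrite mul1r -/(t n).
    transitivity (n.+1%:R * h n * (t n / h n)); last by rewrite mul_step.
    by field; rewrite gt_eqF.
  rewrite -[X in _ --> X]mulr1; apply: cvgM; first exact: cvg_cst.
  by apply: one_sub_expR_slope_cvg => //; exact: step_cvg.
have ce : expR (- h n) @[n --> \oo] --> (1 : R).
  rewrite -[X in _ --> X]expR0.
  apply: (cvg_comp _ expR); last exact: continuous_expR.
  by rewrite -oppr0; apply: cvgN; exact: step_cvg.
have cy : y n @[n --> \oo] --> 0.
  rewrite -(mulr0 (2 * a)); apply: cvgM; first exact: cvg_cst.
  by rewrite -(subrr (1 : R)); apply: cvgB => //; exact: cvg_cst.
have cN : n.+1%:R * (y n / 2) @[n --> \oo] --> a * L.
  have -> : (fun n => n.+1%:R * (y n / 2)) = (fun n => a * (n.+1%:R * t n)).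
    by apply/funext => n; rewrite /y; field.
  by apply: cvgM => //; exact: cvg_cst.
have sqrt_exp u : Num.sqrt (expR (u *+ 2)) = expR u.
  by rewrite mulr2n expRD -expr2 sqrtr_sqr ger0_norm// expR_ge0.
apply: (@squeeze_cvgr _ _ _ _ (fun n => expR (- (n.+1%:R * (y n / 2))))
  (fun n => expR (- (n.+1%:R * (y n / 2) / (1 + y n))))).
- near=> n.
  have y1 : 0 < 1 + y n by rewrite ltr_wpDr.
  rewrite -/(t n) -/(y n) -[n.+1%:R * _ / _]mulrA.
  rewrite -[- (n.+1%:R * (y n / 2))]mulrN -[- (n.+1%:R * (y n / 2 / _))]mulrN.
  rewrite !expRM_natl.
  rewrite !ler_pXn2r ?nnegrE ?expR_ge0 ?invr_ge0 ?sqrtr_ge0//.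
  apply/andP; split.
    rewrite expRN lef_pV2 ?posrE ?expR_gt0 ?sqrtr_gt0//.
    rewrite -sqrt_exp ler_wsqrtr// mulr2n -splitr.
    exact: expR_ge1Dx.
  rewrite expRN lef_pV2 ?posrE ?expR_gt0 ?sqrtr_gt0//.
  rewrite -sqrt_exp ler_wsqrtr//.
  have -> : (y n / 2 / (1 + y n)) *+ 2 = y n / (1 + y n).
    by rewrite mulr2n; field; rewrite gt_eqF.
  rewrite -[leRHS]invrK -[leLHS]invrK lef_pV2 ?posrE ?invr_gt0 ?expR_gt0//.
  rewrite -expRN (le_trans _ (expR_ge1Dx _))//.
  by rewrite le_eqVlt; apply/orP; left; apply/eqP; field; rewrite gt_eqF.
- apply: (cvg_comp _ expR); last exact: continuous_expR.
  exact: cvgN.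
- apply: (cvg_comp _ expR); last exact: continuous_expR.
  apply: cvgN; rewrite -[a * L]divr1 -[in X in _ --> X](addr0 1).
  apply: cvgM => //; apply: cvgV; first by rewrite addr0 oner_neq0.
  by apply: cvgD => //; exact: cvg_cst.
Unshelve. all: by end_near. Qed.

Lemma quadratic_sum_sqr_dist n :
  (\int[P]_w ((expR (- quadratic_sum n w) - expR (- L)) ^+ 2)%:E =
   ((Num.sqrt (1 + 2 * 2 * (1 - expR (- h n))))^-1 ^+ n.+1 + expR (- L) ^+ 2
    - 2 * expR (- L) *
      (Num.sqrt (1 + 2 * 1 * (1 - expR (- h n))))^-1 ^+ n.+1)%:E)%E.
Proof.
set c := expR (- L); set q := quadratic_sum n.
have c0 : 0 <= c by exact: expR_ge0.
have mq : measurable_fun setT q by exact: quadratic_sum_measurable.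
have me (a : R) : measurable_fun setT (fun w => expR (- (a * q w))).
  by apply: measurableT_comp => //; apply: measurableT_comp => //; exact: measurable_funM.
have E : (\int[P]_w ((expR (- q w) - c) ^+ 2)%:E +
    \int[P]_w (2 * c * expR (- (1 * q w)))%:E =
    \int[P]_w (expR (- (2 * q w)))%:E + \int[P]_w (c ^+ 2)%:E)%E.
  rewrite -!ge0_integralD//=.
  - apply: eq_integral => w _; rewrite -!EFinD; congr (_%:E).
    by rewrite mul1r (_ : 2 * q w = q w + q w) ?opprD ?expRD; ring.
  all: try by move=> w _; rewrite lee_fin ?expR_ge0 ?sqr_ge0 ?mulr_ge0 ?expR_ge0.
  all: try by apply/measurable_EFinP.
  - apply/measurable_EFinP; apply: measurable_funX; apply: measurable_funB => //.
    by apply: measurableT_comp => //; exact: measurableT_comp.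
  - by apply/measurable_EFinP; apply: measurable_funM => //; exact: (me 1).
have Ec : (\int[P]_w (c ^+ 2)%:E)%E = (c ^+ 2)%:E.
  by rewrite integral_cst// [X in (_ * X)%E](probability_setT P) mule1.
move: E; rewrite Ec quadratic_sum_laplace//.
under [X in (_ + X)%E]eq_integral do rewrite EFinM.
rewrite ge0_integralZl//; last 2 first.
- exact/measurable_EFinP.
- by rewrite lee_fin mulr_ge0.
rewrite quadratic_sum_laplace// -EFinM -EFinD => E.
by rewrite EFinB -E addeK.
Qed.

(** The Laplace transforms at 1 and 2 show that exp (- quadratic_sum) tends to
    exp (- L) in mean square; no fourth moment of the increments is computed.
    *)
Lemma quadratic_sum_cvg : cvg0_in_prob P (fun n w => quadratic_sum n w - L).
Proof.
have mq n : measurable_fun setT (quadratic_sum n) by exact: quadratic_sum_measurable.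
have me n : measurable_fun setT (fun w => expR (- quadratic_sum n w) - expR (- L)).
  by apply: measurable_funB => //; apply: measurableT_comp => //; exact: measurableT_comp.
apply: (@cvg0_in_prob_dom _ _ _ _ _
  (fun n w => expR (- quadratic_sum n w) - expR (- L))) => //.
- by move=> n; exact: measurable_funB.
- move=> e e0; exists (expR (- L) * (1 - expR (- e))).
    by rewrite mulr_gt0 ?expR_gt0// subr_gt0 expR_lt1 oppr_lt0.
  move=> n w; set q := quadratic_sum n w; rewrite ler_normr => /orP[eq|eq].
    rewrite distrC (le_trans _ (ler_norm _))// mulrBr mulr1 lerD2l lerN2.
    by rewrite -expRD ler_expR; lra.
  apply: (le_trans _ (ler_norm _)).
  have qe : - L + e <= - q by lra.
  apply: (@le_trans _ _ (expR (- L + e) - expR (- L))); last first.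
    by rewrite lerD2r ler_expR.
  have -> : expR (- L + e) - expR (- L) = expR (- L) * (expR e - 1).
    by rewrite expRD; ring.
  rewrite ler_wpM2l ?expR_ge0//.
  by have := expR_ge1Dx e; have := expR_ge1Dx (- e); lra.
- apply: cvg0_in_prob_sqr => //.
  under eq_cvg do rewrite quadratic_sum_sqr_dist.
  apply: cvg_EFin; first exact: nearW.
  have -> : 0 = expR (- (2 * L)) + expR (- L) ^+ 2 - 2 * expR (- L) * expR (- (1 * L)) :> R.
    by rewrite mul1r (_ : 2 * L = L + L) ?opprD ?expRD; ring.
  apply: cvgB; first apply: cvgD; last apply: cvgM; try exact: cvg_cst.
    exact: inv_sqrt_one_add_cvg.
  exact: inv_sqrt_one_add_cvg.
Qed.

End brownian_grid.

(** * Laplace transform and Ito integral of the bridge *)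

Section bridge.
Context d (Omega : measurableType d) (R : realType) (P : probability Omega R).
Variables (W : R -> {RV P >-> R}) (alpha : R) (X : R -> {RV P >-> R}).
Hypotheses (hW : brownian_motion W) (alpha0 : 0 <= alpha).
Hypothesis hX : alpha_brownian_bridge W alpha X.
Variables (L T : R).
Hypotheses (L0 : 0 < L) (TE : T = 1 - expR (- L)).
Let h := step L.
Let h0 n : 0 < h n. Proof. exact: step_gt0. Qed.
Let g n i := grid (h n) i.
Let a n := expR (- (alpha * h n)).

Definition bridge_scheme n i (w : Omega) : R :=
  scheme (a n) (grid_increment W (h n) ^~ w) i.

Definition scheme_energy n (w : Omega) : R :=
  \sum_(i < n.+1) h n * (expR (h n) ^+ i * bridge_scheme n i w ^+ 2).

Definition scheme_terminal n (w : Omega) : R :=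
  expR (h n) ^+ n.+1 * bridge_scheme n n.+1 w ^+ 2.

Definition ito_sum n (w : Omega) : R :=
  \sum_(i < n.+1) X (g n i) w / (1 - g n i) * (X (g n i.+1) w - X (g n i) w).

(** The limit of the discrete energies, in the form of an upper limit to make
    it measurable and with an absolute value to make it nonnegative on the
    null set where the sums may fail to converge. It equals the integral of
    X^2 / (1 - s)^2 almost surely. *)
Definition energy (w : Omega) : R :=
  `|fine (limn_esup (fun n => (scheme_energy n w)%:E))|.

Definition terminal (w : Omega) : R := X T w ^+ 2 / (1 - T).

Lemma bridge_scheme_measurable n i : measurable_fun setT (bridge_scheme n i).
Proof.
elim: i => [|i IH]; first exact: measurable_cst.
apply: measurable_funM => //; apply: measurable_funD => //.
exact: grid_increment_measurable.
Qed.

Lemma scheme_energy_measurable n : measurable_fun setT (scheme_energy n).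
Proof.
apply: measurable_sum => i; apply: measurable_funM => //.
apply: measurable_funM => //; apply: measurable_funX.
exact: bridge_scheme_measurable.
Qed.

Lemma scheme_terminal_measurable n : measurable_fun setT (scheme_terminal n).
Proof.
apply: measurable_funM => //; apply: measurable_funX.
exact: bridge_scheme_measurable.
Qed.

Lemma ito_sum_measurable n : measurable_fun setT (ito_sum n).
Proof.
apply: measurable_sum => i; apply: measurable_funM; first exact: measurable_funM.
exact: measurable_funB.
Qed.

Lemma energy_measurable : measurable_fun setT energy.
Proof.
apply: measurableT_comp => //; apply: measurableT_comp.
  exact: fine_measurable.
apply: measurable_fun_limn_esup => n; apply/measurable_EFinP.
exact: scheme_energy_measurable.
Qed.

Lemma energy_ge0 w : 0 <= energy w. Proof. exact: normr_ge0. Qed.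

Lemma terminal_measurable : measurable_fun setT terminal.
Proof. by apply: measurable_funM => //; exact: measurable_funX. Qed.

Lemma T_lt1 : T < 1. Proof. by rewrite TE ltrBlDr ltrDl expR_gt0. Qed.

Lemma terminal_ge0 w : 0 <= terminal w.
Proof. by rewrite /terminal divr_ge0 ?sqr_ge0// subr_ge0 ltW// T_lt1. Qed.

Lemma bridge_path_limits : {ae P, forall w,
  [/\ scheme_energy n w @[n --> \oo] --> energy w,
      scheme_terminal n w @[n --> \oo] --> terminal w,
      ito_sum n w + 2^-1 * quadratic_sum W L n w @[n --> \oo] -->
        2^-1 * (terminal w - energy w) &
      \int[lebesgue_measure]_(s in `[0, T]) (X s w ^+ 2 / (1 - s) ^+ 2) = energy w]}.
Proof.
apply: filterS hX => w [x0 cx xE].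
have ce := scheme_energy_cvg L0 TE alpha0 x0 cx xE.
have ct := scheme_terminal_cvg L0 TE alpha0 x0 cx xE.
have cl := left_sum_cvg L0 TE alpha0 x0 cx xE.
set I := (X in _ --> X) in ce.
have IE : I = energy w.
  have ceE : (scheme_energy n w)%:E @[n --> \oo] --> I%:E.
    by apply: cvg_EFin; [exact: nearW|exact: ce].
  rewrite /energy is_cvg_limn_esupE; last by apply/cvg_ex; exists I%:E.
  rewrite (cvg_lim _ ceE)//= ger0_norm//.
  apply: Rintegral_ge0 => s; rewrite /= in_itv/= => _.
  by rewrite divr_ge0 ?sqr_ge0.
by split => //; rewrite -?IE.
Qed.

Lemma bridge_scheme_laplace theta x mu n : theta = alpha - 2^-1 -> 0 < theta ->
  0 < x -> 0 <= mu ->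
  (\int[P]_w (expR (- (kappa theta x (h n) / h n * scheme_energy n w +
      mu * scheme_terminal n w)))%:E =
   ((Num.sqrt (riccati (kappa theta x (h n)) (expR (- (theta *+ 2 * h n)))
     (1 - expR (- h n)) n.+1 1 mu))^-1)%:E)%E.
Proof.
move=> thetaE theta0 x0 mu0.
have mE : a n ^+ 2 * expR (h n) = expR (- (theta *+ 2 * h n)).
  by rewrite /a -expRM_natl -expRD thetaE; congr expR; field.
have tau0 : 0 < 1 - expR (- h n) by rewrite subr_gt0 expR_lt1 oppr_lt0.
have kap0 : 0 <= kappa theta x (h n) by exact: kappa_ge0.
rewrite /scheme_energy /scheme_terminal -mE.
move: n.+1 => k.
transitivity (\int[P]_w (expR (- (kappa theta x (h n) *
    (\sum_(i < k) expR (h n) ^+ i * bridge_scheme n i w ^+ 2) +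
    mu / 1 * (expR (h n) ^+ k * bridge_scheme n k w ^+ 2))))%:E)%E.
  apply: eq_integral => w _.
  rewrite divr1.
  have -> : kappa theta x (h n) / h n *
      (\sum_(i < k) h n * (expR (h n) ^+ i * bridge_scheme n i w ^+ 2)) =
      kappa theta x (h n) *
      (\sum_(i < k) expR (h n) ^+ i * bridge_scheme n i w ^+ 2).
    by rewrite -mulr_sumr mulrA divfK// gt_eqF.
  by [].
rewrite (@scheme_laplace _ _ _ P _ (grid_increment_measurable W (h n))
  (grid_sd (h n)) (fun k => grid_increment_indep hW (k := k) (h0 n))
  (fun k => grid_sd_neq0 k (h0 n)) (fun k B => grid_increment_law hW k (h0 n))
  (a n) (expR (h n)) (kappa theta x (h n)) (1 - expR (- h n)) 1 mu k) //.
- by rewrite sqrtr1 div1r.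
- by rewrite /a expR_ge0.
- exact: expR_gt0.
- exact: ltW.
- by move=> i; apply: grid_sd_sqr; exact: ltW.
Qed.

(** Both sides are the limit of the discrete Laplace transforms: the left one
    by bounded convergence, the right one by the closed form. *)
Lemma bridge_laplace theta x mu : theta = alpha - 2^-1 -> 0 < theta ->
  0 < x -> 0 <= mu ->
  (\int[P]_w (expR (- (x * (theta + x / 2) * energy w + mu * terminal w)))%:E =
   ((Num.sqrt (riccati_lim theta x mu L))^-1)%:E)%E.
Proof.
move=> thetaE theta0 x0 mu0.
pose f n w := expR (- (kappa theta x (h n) / h n * scheme_energy n w +
      mu * scheme_terminal n w)).
have ck := @kappa_cvg _ h theta x h0 (step_cvg L).
have kap0 n : 0 <= kappa theta x (h n) / h n.
  by rewrite divr_ge0 ?kappa_ge0// ltW.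
have lim1 : (\int[P]_w (f n w)%:E)%E @[n --> \oo] -->
    (\int[P]_w (expR (- (x * (theta + x / 2) * energy w + mu * terminal w)))%:E)%E.
  apply: (@bounded_convergence _ _ _ P f _ 1).
  - move=> n; apply: measurableT_comp => //; apply: measurableT_comp => //.
    apply: measurable_funD; apply: measurable_funM => //.
      exact: scheme_energy_measurable.
    exact: scheme_terminal_measurable.
  - apply: measurableT_comp => //; apply: measurableT_comp => //.
    apply: measurable_funD; apply: measurable_funM => //.
      exact: energy_measurable.
    exact: terminal_measurable.
  - apply: filterS bridge_path_limits => w [ce ct _ _].
    apply: (cvg_comp _ expR); last exact: continuous_expR.
    apply: cvgN; apply: cvgD; apply: cvgM => //; exact: cvg_cst.
  - move=> n w; rewrite ger0_norm ?expR_ge0// -expR0 ler_expR oppr_le0.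
    rewrite addr_ge0// mulr_ge0//.
      apply: sumr_ge0 => i _; rewrite mulr_ge0 ?(ltW (h0 n))//.
      by rewrite mulr_ge0 ?sqr_ge0 ?exprn_ge0 ?expR_ge0.
    by rewrite mulr_ge0 ?sqr_ge0 ?exprn_ge0 ?expR_ge0.
have lim2 : (\int[P]_w (f n w)%:E)%E @[n --> \oo] -->
    ((Num.sqrt (riccati_lim theta x mu L))^-1)%:E.
  under eq_cvg do rewrite bridge_scheme_laplace//.
  apply: cvg_EFin; first exact: nearW.
  apply: cvgV.
    by rewrite gt_eqF// sqrtr_gt0 riccati_lim_gt0.
  apply: (cvg_comp _ Num.sqrt); last exact: sqrt_continuous.
  exact: riccati_cvg.
exact: (cvg_unique _ lim1 lim2).
Qed.

Definition grid_points n := [seq g n i | i <- iota 1 n.+1].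

Lemma size_grid_points n : size (grid_points n) = n.+1.
Proof. by rewrite size_map size_iota. Qed.

Lemma grid_pointsE n : 0 :: grid_points n = [seq g n i | i <- iota 0 n.+2].
Proof. by rewrite /grid_points [iota 0 _]/= [in RHS]map_cons /g grid0. Qed.

Lemma nth_grid_points n i : (i <= n.+1)%N -> nth T (0 :: grid_points n) i = g n i.
Proof.
by move=> ni; rewrite grid_pointsE (nth_map 0%N) ?size_iota ?ltnS// nth_iota.
Qed.

Lemma grid_points_partition n : itv_partition 0 T (grid_points n).
Proof.
split.
  rewrite -(grid0 (h n)) -/(g n 0) /grid_points path_map.
  apply: sub_path (iota_ltn_sorted 0 n.+2) => i j ij /=.
  exact: grid_lt.
rewrite (last_nth T) size_grid_points nth_grid_points//.
by apply/eqP; exact: grid_last.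
Qed.

Lemma left_sum_grid n w :
  left_sum 0 T (fun s w => X s w / (1 - s)) (fun s w => X s w) (grid_points n) w =
  ito_sum n w.
Proof.
rewrite /left_sum /ito_sum.
rewrite -(big_mkord xpredT (fun i => X (nth T (0 :: grid_points n) i) w /
  (1 - nth T (0 :: grid_points n) i) * (X (nth T (0 :: grid_points n) i.+1) w
   - X (nth T (0 :: grid_points n) i) w))).
rewrite size_grid_points big_mkord; apply: eq_bigr => i _.
by rewrite !nth_grid_points// ltnW.
Qed.

Lemma mesh_grid n delta : h n < delta -> mesh_lt 0 T (grid_points n) delta.
Proof.
move=> hd t i; rewrite size_grid_points => ni; rewrite /t.
rewrite !nth_grid_points ?(ltnW ni)//.
by rewrite (le_lt_trans _ hd)// gridS_sub// ltW.
Qed.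

(** Limits in probability are unique, so the Ito integral may be computed
    along the grids. *)
Lemma ito_integral_value (I : {RV P >-> R}) :
  is_ito_integral 0 T (fun s w => X s w / (1 - s)) (fun s w => X s w) I ->
  {ae P, forall w, I w = 2^-1 * (terminal w - energy w - L)}.
Proof.
move=> hI.
have mlim : measurable_fun setT (fun w => 2^-1 * (terminal w - energy w)).
  apply: measurable_funM => //; apply: measurable_funB.
    exact: terminal_measurable.
  exact: energy_measurable.
have mQ n : measurable_fun setT (quadratic_sum W L n).
  exact: quadratic_sum_measurable.
have mS n : measurable_fun setT (ito_sum n) by exact: ito_sum_measurable.
have cI : cvg0_in_prob P (fun n w => - (ito_sum n w - I w)).
  move=> e eta e0 eta0; have [delta delta0 H] := hI _ _ e0 eta0.
  near=> n; have hd : h n < delta.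
    by near: n; apply: (cvgr_lt (0 : R)) => //; exact: step_cvg.
  have := H _ (grid_points_partition n) (mesh_grid hd).
  by under eq_set do rewrite left_sum_grid -normrN.
have cV : cvg0_in_prob P (fun n w => ito_sum n w + 2^-1 * quadratic_sum W L n w
    - 2^-1 * (terminal w - energy w)).
  apply: cvg0_in_prob_ae.
    move=> n; apply: measurable_funB => //; apply: measurable_funD => //.
    exact: measurable_funM.
  apply: filterS bridge_path_limits => w [_ _ cw _].
  by rewrite -[X in _ --> X](subrr (2^-1 * (terminal w - energy w)));
    apply: cvgB => //; exact: cvg_cst.
have cQ : cvg0_in_prob P (fun n w => - 2^-1 * (quadratic_sum W L n w - L)).
  apply: (cvg0_in_prob_dom _ _ _ (quadratic_sum_cvg hW L0)).
  - by move=> n; apply: measurable_funM => //; exact: measurable_funB.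
  - by move=> n; exact: measurable_funB.
  - move=> e e0; exists e => // n w.
    rewrite normrM normrN normfV normr_nat => /le_trans; apply.
    by rewrite ler_piMl// invf_le1 ?ler1n.
have : {ae P, forall w, I w - 2^-1 * (terminal w - energy w - L) = 0}.
  apply: (@cvg0_in_prob_cst _ _ _ _ (fun w => I w - 2^-1 * (terminal w - energy w - L))).
    apply: measurable_funB => //; apply: measurable_funM => //.
    apply: measurable_funB => //; apply: measurable_funB.
      exact: terminal_measurable.
    exact: energy_measurable.
  have -> : (fun=> (fun w => I w - 2^-1 * (terminal w - energy w - L))) =
      (fun n w => - (ito_sum n w - I w) + (ito_sum n w +
        2^-1 * quadratic_sum W L n w - 2^-1 * (terminal w - energy w)) +
        - 2^-1 * (quadratic_sum W L n w - L)).
    by apply/funext => n; apply/funext => w; field.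
  apply: cvg0_in_probD cQ => [n|n|].
  - apply: measurable_funD.
      by apply: measurableT_comp => //; exact: measurable_funB.
    apply: measurable_funB => //; apply: measurable_funD => //.
    exact: measurable_funM.
  - by apply: measurable_funM => //; exact: measurable_funB.
  apply: cvg0_in_probD cV => // n.
    by apply: measurableT_comp => //; exact: measurable_funB.
  apply: measurable_funB => //; apply: measurable_funD => //.
  exact: measurable_funM.
apply: filterS => w /eqP; rewrite subr_eq0 => /eqP ->.
by [].
Unshelve. all: by end_near. Qed.

End bridge.

(** * Integrals over the half-line *)

Section half_line_integrals.
Context {R : realType}.
Notation mu := (@lebesgue_measure R).

(** Differentiability on the whole line settles the boundary conditions at 0. *)
Lemma integral_half_line_primitive (f F : R -> R) (l : R) :
  (forall x, 0 <= x -> 0 <= f x) -> continuous f ->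
  (forall x : R, is_derive x 1 F (f x)) -> F x @[x --> +oo] --> l ->
  (\int[mu]_(x in `[0%R, +oo[) (f x)%:E = (l - F 0)%:E)%E.
Proof.
move=> f0 cf dF Fl.
have cF : F x @[x --> 0^'+] --> F 0.
  apply: cvg_at_right_filter.
  by apply/differentiable_continuous/derivable1_diffP; have [] := dF 0.
rewrite (ge0_continuous_FTC2y f0 (continuous_subspaceT cf) Fl)//.
by move=> x _; rewrite derive1E; have [_] := dF x.
Qed.

Lemma is_derive_poly_expR (a c0 c1 c2 x : R) : a != 0 ->
  is_derive x 1 (fun x => - ((c0 / a + c1 * (x / a + a ^- 2) +
     c2 * (x ^+ 2 / a + 2 * x / a ^+ 2 + 2 / a ^+ 3)) * expR (- (a * x))))
   ((c0 + c1 * x + c2 * x ^+ 2) * expR (- (a * x))).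
Proof.
move=> a0.
have dH : is_derive x 1 (fun x : R => - (a * x)) (- a).
  by apply: is_derive_eq; rewrite /GRing.scale/=; ring.
have dE := @is_derive1_comp _ (@expR R) _ _ _ _ (is_derive_expR _) dH.
have dG : is_derive x 1 (fun x => c0 / a + c1 * (x / a + a ^- 2) +
     c2 * (x ^+ 2 / a + 2 * x / a ^+ 2 + 2 / a ^+ 3)) (c1 / a + c2 * (2 * x / a + 2 / a ^+ 2)).
  by apply: is_derive_eq; rewrite /GRing.scale/=; field.
have := is_deriveN (is_deriveM dG dE).
set D := (X in is_derive _ _ _ X -> _).
have -> : D = (c0 + c1 * x + c2 * x ^+ 2) * expR (- (a * x)).
  by rewrite /D /GRing.scale/=; field.
exact.
Qed.

Lemma exprn_expR_cvg0 (a : R) k : 0 < a ->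
  x ^+ k * expR (- (a * x)) @[x --> +oo] --> 0.
Proof.
move=> a0; pose K := k.+1`!%:R / a ^+ k.+1.
have cV : x^-1 @[x --> +oo] --> (0 : R).
  by apply/gtr0_cvgV0; [exact: nbhs_pinfty_gt|exact: cvg_id].
apply: (@squeeze_cvgr _ _ _ _ (cst 0) (fun x => K * x^-1)); last 2 first.
- exact: cvg_cst.
- by rewrite -(mulr0 K); apply: cvgM => //; exact: cvg_cst.
near=> x.
have x0 : 0 < x by near: x; exact: nbhs_pinfty_gt.
rewrite /cst mulr_ge0 ?exprn_ge0 ?expR_ge0 ?(ltW x0)//= expRN ler_pdivrMr ?expR_gt0//.
have ax : 0 <= a * x by rewrite mulr_ge0// ltW.
have := expR_ge1Dxn k ax => le1.
have le2 : (a * x) ^+ k.+1 / k.+1`!%:R <= expR (a * x).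
  by apply: le_trans le1; rewrite lerDr.
apply: (@le_trans _ _ (K * x^-1 * ((a * x) ^+ k.+1 / k.+1`!%:R))); last first.
  by rewrite ler_wpM2l// mulr_ge0 ?divr_ge0 ?exprn_ge0 ?invr_ge0// ltW.
rewrite /K exprMn [x ^+ k.+1]exprS le_eqVlt; apply/orP; left; apply/eqP; field.
by rewrite pnatr_eq0 -lt0n fact_gt0 expf_neq0 gt_eqF.
Unshelve. all: by end_near. Qed.

Lemma integral_poly_expR (a c0 c1 c2 : R) :
  0 < a -> 0 <= c0 -> 0 <= c1 -> 0 <= c2 ->
  (\int[mu]_(x in `[0%R, +oo[) ((c0 + c1 * x + c2 * x ^+ 2) * expR (- (a * x)))%:E
   = (c0 / a + c1 / a ^+ 2 + 2 * c2 / a ^+ 3)%:E)%E.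
Proof.
move=> a0 c00 c10 c20.
rewrite (integral_half_line_primitive (l := 0) _ _
  (fun x => is_derive_poly_expR c0 c1 c2 x (lt0r_neq0 a0))).
- rewrite sub0r opprK [a * 0]mulr0 oppr0 expR0; congr (_%:E); field.
  by rewrite gt_eqF.
- by move=> x x0; rewrite mulr_ge0 ?expR_ge0// !addr_ge0// mulr_ge0// exprn_ge0.
- move=> x; apply: cvgM; last first.
    apply: (cvg_comp _ expR); last exact: continuous_expR.
    by apply: cvgN; apply: cvgM; [exact: cvg_cst|exact: cvg_id].
  apply: cvgD; last by apply: cvgM; [exact: cvg_cst|exact: exprn_continuous].
  by apply: cvgD; [exact: cvg_cst|apply: cvgM; [exact: cvg_cst|exact: cvg_id]].
- have -> : (fun x : R => - ((c0 / a + c1 * (x / a + a ^- 2) +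
     c2 * (x ^+ 2 / a + 2 * x / a ^+ 2 + 2 / a ^+ 3)) * expR (- (a * x)))) =
     (fun x => - ((c0 / a + c1 / a ^+ 2 + 2 * c2 / a ^+ 3) * (x ^+ 0 * expR (- (a * x)))
     + (c1 / a + 2 * c2 / a ^+ 2) * (x ^+ 1 * expR (- (a * x)))
     + (c2 / a) * (x ^+ 2 * expR (- (a * x))))).
    apply/funext => x; rewrite expr0 expr1; field.
    by rewrite gt_eqF.
  rewrite -[X in _ --> X]oppr0; apply: cvgN.
  rewrite -[X in _ --> X]addr0; apply: cvgD.
    rewrite -[X in _ --> X]addr0; apply: cvgD.
      by rewrite -[X in _ --> X](mulr0 (c0 / a + c1 / a ^+ 2 + 2 * c2 / a ^+ 3));
        apply: cvgM; [exact: cvg_cst|exact: exprn_expR_cvg0].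
    by rewrite -[X in _ --> X](mulr0 (c1 / a + 2 * c2 / a ^+ 2));
      apply: cvgM; [exact: cvg_cst|exact: exprn_expR_cvg0].
  by rewrite -[X in _ --> X](mulr0 (c2 / a));
    apply: cvgM; [exact: cvg_cst|exact: exprn_expR_cvg0].
Qed.

(** This is 1 / S = int_0^oo exp (- lambda S) dlambda after the substitution
    lambda = x (theta + x / 2). In the variable x the Laplace transform of S
    is close to exp (- L x / 2), whatever theta. *)
Lemma integral_inverse (theta S : R) : 0 < theta -> 0 < S ->
  (\int[mu]_(x in `[0%R, +oo[)
     ((theta + x) * expR (- (x * (theta + x / 2) * S)))%:E = (S^-1)%:E)%E.
Proof.
move=> theta0 S0.
have dF (x : R) : is_derive x 1 (fun x => - (S^-1 * expR (- (x * (theta + x / 2) * S))))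
    ((theta + x) * expR (- (x * (theta + x / 2) * S))).
  have dH : is_derive x 1 (fun x : R => - (x * (theta + x / 2) * S)) (- ((theta + x) * S)).
    by apply: is_derive_eq; rewrite /GRing.scale/=; field.
  have dE := @is_derive1_comp _ (@expR R) _ _ _ _ (is_derive_expR _) dH.
  have := is_deriveN (is_deriveZ S^-1 dE).
  set D := (X in is_derive _ _ _ X -> _).
  have -> : D = (theta + x) * expR (- (x * (theta + x / 2) * S)).
    by rewrite /D /GRing.scale/=; field; rewrite gt_eqF.
  exact.
rewrite (integral_half_line_primitive (l := 0) _ _ dF).
- by rewrite !mul0r oppr0 expR0 mulr1 sub0r opprK.
- by move=> x x0; rewrite mulr_ge0 ?expR_ge0// addr_ge0// ltW.
- move=> x; apply: cvgM.
    by apply: cvgD; [exact: cvg_cst|exact: cvg_id].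
  apply: (cvg_comp _ expR); last exact: continuous_expR.
  apply: cvgN; apply: cvgM; last exact: cvg_cst.
  apply: cvgM; first exact: cvg_id.
  apply: cvgD; first exact: cvg_cst.
  by apply: cvgM; [exact: cvg_id|exact: cvg_cst].
- rewrite -oppr0; apply: cvgN; rewrite -(mulr0 S^-1); apply: cvgM; first exact: cvg_cst.
  apply: (@squeeze_cvgr _ _ _ _ (cst 0) (fun x => x ^+ 0 * expR (- (theta * S * x)))).
  - near=> x; have x0 : 0 <= x by near: x; exact: nbhs_pinfty_ge.
    rewrite expR_ge0/= expr0 mul1r ler_expR lerN2.
    rewrite [leRHS](_ : _ = theta * S * x + x ^+ 2 * S / 2); last by field.
    by rewrite lerDl divr_ge0// mulr_ge0 ?sqr_ge0// ltW.
  - exact: cvg_cst.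
  - by apply: exprn_expR_cvg0; rewrite mulr_gt0.
Unshelve. all: by end_near. Qed.

End half_line_integrals.

(** * Bounds on the Laplace transform *)

Section riccati_bounds.
Context {R : realType}.

Lemma inv_sqrt_one_sub_bounds (d : R) : 0 <= d -> d <= 2^-1 ->
  1 + d / 2 <= (Num.sqrt (1 - d))^-1 <= 1 + d / 2 + d ^+ 2.
Proof.
move=> d0 d2.
have s0 : 0 < Num.sqrt (1 - d) by rewrite sqrtr_gt0; lra.
have s2 : Num.sqrt (1 - d) ^+ 2 = 1 - d by rewrite sqr_sqrtr//; lra.
have dd0 : 0 <= d ^+ 2 by exact: sqr_ge0.
have ddd0 : 0 <= d ^+ 3 by exact: exprn_ge0.
rewrite -[X in _ <= X <= _]div1r ler_pdivlMr// ler_pdivrMr//; apply/andP; split.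
  rewrite -ler_sqr ?nnegrE ?mulr_ge0 ?(ltW s0) ?addr_ge0 ?divr_ge0//.
  rewrite exprMn s2 expr1n.
  rewrite (_ : _ * _ = 1 - (3 / 4 * d ^+ 2 + d ^+ 3 / 4)); last by field.
  lra.
rewrite -ler_sqr ?nnegrE ?mulr_ge0 ?(ltW s0) ?addr_ge0 ?divr_ge0//.
rewrite exprMn s2 expr1n.
rewrite (_ : (1 + d / 2 + d ^+ 2) ^+ 2 * (1 - d) =
  1 + d ^+ 2 * (5 / 4 - 5 / 4 * d - d ^+ 3)); last by field.
rewrite lerDl mulr_ge0//.
have : d ^+ 3 <= 2^-1 * 1.
  rewrite exprS ler_pM ?exprn_ge0//.
  by rewrite exprn_ile1//; lra.
lra.
Qed.

Lemma inv_sqrt_cube_bounds (d : R) : 0 <= d -> d <= 2^-1 ->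
  1 <= (Num.sqrt (1 - d) ^+ 3)^-1 <= 1 + 6 * d.
Proof.
move=> d0 d2; set s := Num.sqrt (1 - d).
have s0 : 0 < s by rewrite sqrtr_gt0; lra.
have s2 : s ^+ 2 = 1 - d by rewrite sqr_sqrtr//; lra.
have s1 : s <= 1 by rewrite -ler_sqr ?nnegrE ?(ltW s0)// s2 expr1n; lra.
have s30 : 0 < s ^+ 3 by exact: exprn_gt0.
rewrite -[X in _ <= X <= _]div1r ler_pdivlMr// ler_pdivrMr// mul1r.
rewrite exprn_ile1 ?(ltW s0)//=.
apply: (@le_trans _ _ ((1 + 6 * d) * (1 - d) ^+ 2)).
  rewrite (_ : _ * _ = 1 + d * ((1 - 2 * d) * (4 - 3 * d))); last by ring.
  by rewrite lerDl mulr_ge0// mulr_ge0//; lra.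
apply: ler_wpM2l; first by lra.
by rewrite -s2 -exprM (exprS s 3) ler_piMl// ltW.
Qed.

Variables (theta x L : R).
Hypotheses (theta0 : 0 < theta) (x0 : 0 < x) (L0 : 0 < L).

Let eps := expR (- (2 * (theta + x) * L)).
Let d := x * (1 - eps) / (2 * (theta + x)).

(** Isolates the dominant exponential; d is at most x / (2 theta). *)
Lemma riccati_limE mu : riccati_lim theta x mu L =
  expR (x * L) * (1 - d + mu * ((1 - eps) / (theta + x))).
Proof.
have g0 : theta + x != 0 by rewrite gt_eqF// addr_gt0.
rewrite /riccati_lim (_ : expR (- _) = expR (x * L) * eps); last first.
  by rewrite /eps -expRD; congr expR; ring.
by rewrite /d; field.
Qed.

Let eps0 : 0 < eps. Proof. exact: expR_gt0. Qed.

Let eps1 : eps <= expR (- (2 * theta * L)).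
Proof.
by rewrite ler_expR lerN2 ler_wpM2r ?(ltW L0)// mulrDr lerDl mulr_ge0// ltW.
Qed.

Let eps_le1 : eps <= 1.
Proof. by rewrite -expR0 ler_expR oppr_le0 !mulr_ge0 ?addr_ge0 ?ltW. Qed.

Let g0 : 0 < theta + x. Proof. exact: addr_gt0. Qed.

Let d0 : 0 <= d.
Proof.
rewrite /d divr_ge0//; first by rewrite mulr_ge0 ?subr_ge0// ltW.
by rewrite mulr_ge0// ltW.
Qed.

Let dE : (theta + x) * d = x * (1 - eps) / 2.
Proof. by rewrite /d; field; rewrite gt_eqF. Qed.

Let d_le : d <= x / (2 * (theta + x)).
Proof.
rewrite /d ler_pM2r ?invr_gt0 ?mulr_gt0// ler_piMr ?(ltW x0)//.
by rewrite lerBlDr lerDl ltW.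
Qed.

Let d2 : d <= 2^-1.
Proof.
rewrite (le_trans d_le)// ler_pdivrMr ?mulr_gt0// mulrA mulVf// mul1r.
by rewrite lerDr ltW.
Qed.

Let dt : d <= x / (2 * theta).
Proof.
rewrite (le_trans d_le)// ler_pM2l// lef_pV2 ?posrE ?mulr_gt0//.
by rewrite ler_pM2l// lerDl ltW.
Qed.

Let sqrt_riccati_lim : Num.sqrt (riccati_lim theta x 0 L) =
  expR (L / 2 * x) * Num.sqrt (1 - d).
Proof.
rewrite riccati_limE mul0r addr0 sqrtrM ?expR_ge0//; congr (_ * _).
have -> : x * L = L / 2 * x + L / 2 * x by field.
by rewrite expRD -expr2 sqrtr_sqr ger0_norm// expR_ge0.
Qed.

(** To first order in d the middle term is (theta + x) (1 + d / 2) exp (- L x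
    / 2), and (theta + x) d = x (1 - eps) / 2; this is where the coefficient
    5/4 = 1 + 1/4 of x comes from. *)
Lemma energy_density_bounds :
  (theta + (5 - expR (- (2 * theta * L))) / 4 * x) * expR (- (L / 2 * x)) <=
  (theta + x) / Num.sqrt (riccati_lim theta x 0 L) <=
  (theta + 5 / 4 * x + (4 * theta)^-1 * x ^+ 2) * expR (- (L / 2 * x)).
Proof.
rewrite sqrt_riccati_lim.
have s0 : 0 < Num.sqrt (1 - d) by rewrite sqrtr_gt0; move: d2; lra.
have -> : (theta + x) / (expR (L / 2 * x) * Num.sqrt (1 - d)) =
    (theta + x) * (Num.sqrt (1 - d))^-1 * expR (- (L / 2 * x)).
  by rewrite expRN; field; rewrite !gt_eqF ?expR_gt0.
have /andP[lo hi] := inv_sqrt_one_sub_bounds d0 d2.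
apply/andP; split; rewrite ler_wpM2r ?expR_ge0//.
  apply: (le_trans _ (ler_wpM2l (ltW g0) lo)).
  rewrite (_ : _ * (1 + _) = theta + x + (theta + x) * d / 2); last by ring.
  rewrite dE.
  have := ler_wpM2l (ltW x0) eps1; lra.
apply: (le_trans (ler_wpM2l (ltW g0) hi)).
rewrite (_ : _ * (1 + _ + _) = theta + x + (theta + x) * d / 2 +
  (theta + x) * d * d); last by ring.
have xd : (theta + x) * d <= x / 2.
  rewrite dE ler_pM2r// ler_piMr ?(ltW x0)//.
  by rewrite lerBlDr lerDl ltW.
have gd : (theta + x) * d * d <= (4 * theta)^-1 * x ^+ 2.
  apply: (@le_trans _ _ (x / 2 * (x / (2 * theta)))).
    by apply: ler_pM => //; rewrite mulr_ge0// ltW.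
  by rewrite le_eqVlt; apply/orP; left; apply/eqP; field; rewrite gt_eqF.
lra.
Qed.

(** The derivative of [riccati_lim] in mu. *)
Definition riccati_slope : R :=
  (expR (x * L) - expR (- ((theta *+ 2 + x) * L))) / (theta + x).

Lemma terminal_density_bounds :
  2^-1 * (1 - expR (- (2 * theta * L))) * expR (- (L / 2 * x)) <=
  (theta + x) * (riccati_slope / (2 * Num.sqrt (riccati_lim theta x 0 L) ^+ 3)) <=
  (2^-1 + 3 / (2 * theta) * x) * expR (- (L / 2 * x)).
Proof.
have -> : riccati_slope = expR (L / 2 * x) ^+ 2 * (1 - eps) / (theta + x).
  rewrite /riccati_slope -expRM_natl; congr (_ / _).
  by rewrite mulrBr mulr1 /eps -expRD; congr (expR _ - expR _); field.
rewrite sqrt_riccati_lim [expR (- (L / 2 * x))]expRN.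
set E := expR (L / 2 * x); set s := Num.sqrt (1 - d).
have E0 : 0 < E by exact: expR_gt0.
have s0 : 0 < s by rewrite sqrtr_gt0; move: d2; lra.
have -> : (theta + x) * (E ^+ 2 * (1 - eps) / (theta + x) / (2 * (E * s) ^+ 3)) =
   2^-1 * (1 - eps) * (s ^+ 3)^-1 / E.
  by field; rewrite !gt_eqF.
have /andP[lo hi] := inv_sqrt_cube_bounds d0 d2.
apply/andP; split; rewrite ler_pM2r ?invr_gt0//.
  rewrite -[leLHS]mulr1 ler_pM//; last by rewrite ler_pM2l// lerD2l lerN2.
  rewrite mulr_ge0// subr_ge0 -expR0 ler_expR oppr_le0 !mulr_ge0//; exact: ltW.
apply: (@le_trans _ _ (2^-1 * 1 * (1 + 6 * d))).
  rewrite ler_pM//; last by rewrite ler_pM2l// lerBlDr lerDl ltW.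
    by rewrite mulr_ge0// subr_ge0.
  by rewrite invr_ge0 exprn_ge0// ltW.
have -> : 3 / (2 * theta) * x = 3 * (x / (2 * theta)) by field; rewrite gt_eqF.
by move: dt; set u := x / (2 * theta) => du; lra.
Qed.

End riccati_bounds.

(** * Inverse moments from Laplace transforms *)

Section tonelli.
Context d (T : measurableType d) (R : realType) (P : probability T R).
Notation mu := (@lebesgue_measure R).

Lemma tonelli_restrict (D : set R) (G : T * measurableTypeR R -> R) :
  measurable D -> measurable_fun setT G -> (forall z, 0 <= G z) ->
  [/\ measurable_fun setT (fun w => \int[mu]_(x in D) (G (w, x))%:E)%E,
      measurable_fun D (fun x => \int[P]_w (G (w, x))%:E)%E &
      (\int[P]_w \int[mu]_(x in D) (G (w, x))%:E =
       \int[mu]_(x in D) \int[P]_w (G (w, x))%:E)%E].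
Proof.
move=> mD mG G0.
pose f (z : T * measurableTypeR R) := (G z * \1_D z.2)%:E.
have mf : measurable_fun setT f.
  apply/measurable_EFinP; apply: measurable_funM => //.
  exact: measurableT_comp (measurable_indic mD) measurable_snd.
have f0 z : (0 <= f z)%E by rewrite lee_fin mulr_ge0.
have E w : (\int[mu]_(x in D) (G (w, x))%:E = \int[mu]_x f (w, x))%E.
  rewrite integral_mkcond; apply: eq_integral => x _.
  by rewrite patchE /f /= indicE; case: ifP => xD; rewrite ?mulr1 ?mulr0.
split.
- under eq_fun do rewrite E.
  exact: (@measurable_fun_fubini_tonelli_F _ _ _ _ _ mu).
- have mGx := @measurable_fun_fubini_tonelli_G _ _ _ _ _ P f mf f0.
  apply: (eq_measurable_fun (fun x => \int[P]_w f (w, x))%E); last first.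
    exact: measurable_funTS.
  move=> x xD; apply: eq_integral => w _.
  by rewrite /f/= indicE xD mulr1.
under eq_integral do rewrite E.
rewrite (@fubini_tonelli _ _ _ _ _ P mu f mf f0) [RHS]integral_mkcond.
apply: eq_integral => x _; rewrite patchE /f /= indicE; case: ifP => xD.
  by under eq_integral do rewrite mulr1.
by under eq_integral do rewrite mulr0; rewrite integral0.
Qed.

End tonelli.

Section inverse_moments.
Context d (T : measurableType d) (R : realType) (P : probability T R).
Notation mu := (@lebesgue_measure R).
Variables (S Q : T -> R) (theta L : R).
Hypotheses (mS : measurable_fun setT S) (mQ : measurable_fun setT Q).
Hypotheses (S0 : forall w, 0 <= S w) (Q0 : forall w, 0 <= Q w).
Hypotheses (theta0 : 0 < theta) (L0 : 0 < L).
Hypothesis laplace : forall x m : R, 0 < x -> 0 <= m ->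
  (\int[P]_w (expR (- (x * (theta + x / 2) * S w + m * Q w)))%:E =
   ((Num.sqrt (riccati_lim theta x m L))^-1)%:E)%E.

Let rate x : R := x * (theta + x / 2).

Let rate_ge0 x : 0 <= x -> 0 <= rate x.
Proof. by move=> x0; rewrite mulr_ge0// addr_ge0 ?divr_ge0// ltW. Qed.

Lemma laplace_energy x : 0 < x ->
  (\int[P]_w (expR (- (rate x * S w)))%:E =
   ((Num.sqrt (riccati_lim theta x 0 L))^-1)%:E)%E.
Proof.
move=> x0; rewrite -laplace//; apply: eq_integral => w _.
by rewrite mul0r addr0.
Qed.

(** The probability of S = 0 is at most the Laplace transform of S at every
    point, which tends to 0 at infinity. *)
Lemma energy_pos : {ae P, forall w, 0 < S w}.
Proof.
pose E := [set w | S w = 0].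
have mE : measurable E.
  by rewrite (_ : E = S @^-1` [set 0])// -[X in measurable X]setTI; exact: mS.
have PE x : 0 < x -> (P E <= ((Num.sqrt (riccati_lim theta x 0 L))^-1)%:E)%E.
  move=> x0; rewrite -laplace_energy// -[E]setIT -integral_indic//.
  apply: ge0_le_integral => //.
  - by apply/measurable_EFinP; exact: measurable_indic.
  - apply/measurable_EFinP; apply: measurableT_comp => //.
    by apply: measurableT_comp => //; exact: measurable_funM.
  - move=> w _; rewrite lee_fin indicE; case: (boolP (w \in E)) => [|_]; last exact: expR_ge0.
    by rewrite inE /E/= => ->; rewrite mulr0 oppr0 expR0.
have PEfin : P E \is a fin_num by rewrite fin_num_measure.
(* F bounds the Laplace transform of S at x, by [energy_density_bounds]. *)
pose F (x : R) := theta^-1 * ((theta * (x ^+ 0 * expR (- (L / 2 * x))) +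
  5 / 4 * (x ^+ 1 * expR (- (L / 2 * x)))) +
  (4 * theta)^-1 * (x ^+ 2 * expR (- (L / 2 * x)))).
have cF : F x @[x --> +oo] --> 0.
  have L20 : 0 < L / 2 by rewrite divr_gt0.
  rewrite (_ : 0 = theta^-1 * ((theta * 0 + 5 / 4 * 0) + (4 * theta)^-1 * 0)); last first.
    by rewrite !mulr0 !addr0 mulr0.
  by apply: cvgM; [exact: cvg_cst|apply: cvgD; [apply: cvgD|]];
    apply: cvgM; (exact: cvg_cst || exact: exprn_expR_cvg0).
have PEF x : 0 < x -> fine (P E) <= F x.
  move=> x0; have := PE x x0; rewrite -[P E]fineK// lee_fin => /le_trans; apply.
  have /andP[_ hi] := energy_density_bounds theta0 x0 L0.
  rewrite /F ler_pdivlMl//.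
  rewrite expr0 expr1 mul1r mulrA [(4 * theta)^-1 * (_ * _)]mulrA -!mulrDl.
  apply: le_trans hi.
  by rewrite ler_wpM2r ?invr_ge0 ?sqrtr_ge0// lerDl ltW.
have PE0 : P E = 0%E.
  rewrite -[P E]fineK//; congr (_%:E); apply/eqP; rewrite eq_le fine_ge0// andbT.
  rewrite leNgt; apply/negP => p0.
  have [x [Fx x0]] : exists x, F x < fine (P E) /\ 0 < x.
    have H : \forall x \near +oo, F x < fine (P E) /\ 0 < x.
      near=> x; split; near: x; first exact: (cvgr_lt _ cF).
      exact: nbhs_pinfty_gt.
    by have [x Hx] := filter_ex H; exists x.
  by have := le_lt_trans (PEF x x0) Fx; rewrite ltxx.
exists E; split => // w /= /negP; rewrite -leNgt => Sw.
by apply/eqP; rewrite eq_le Sw S0.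
Unshelve. all: by end_near. Qed.

(** Tonelli applied to V / S = int_0^oo (theta + x) V exp (- x (theta + x / 2)
    S) dx. *)
Lemma integral_ratio (V : T -> R) (g : R -> R) :
  measurable_fun setT V -> (forall w, 0 <= V w) ->
  (forall x, 0 < x -> (\int[P]_w (V w * expR (- (rate x * S w)))%:E = (g x)%:E)%E) ->
  measurable_fun (`]0, +oo[%classic : set R) (fun x => ((theta + x) * g x)%:E) /\
  (\int[P]_w (V w / S w)%:E =
   \int[mu]_(x in `]0%R, +oo[) ((theta + x) * g x)%:E)%E.
Proof.
move=> mV V0 Vg.
pose G (z : T * measurableTypeR R) :=
  (theta + `|z.2 : R|) * (V z.1 * expR (- (rate z.2 * S z.1))).
have mx : measurable_fun setT (fun z : T * measurableTypeR R => z.2 : R).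
  exact: measurable_snd.
have mG : measurable_fun setT G.
  apply: measurable_funM.
    by apply: measurable_funD => //; exact: measurableT_comp.
  apply: measurable_funM; first exact: (measurableT_comp mV measurable_fst).
  apply: measurableT_comp => //; apply: measurableT_comp => //.
  apply: measurable_funM; last exact: (measurableT_comp mS measurable_fst).
  by apply: measurable_funM => //; apply: measurable_funD => //; exact: measurable_funM.
have G0 z : 0 <= G z.
  by rewrite mulr_ge0 ?addr_ge0 ?(ltW theta0)// mulr_ge0 ?expR_ge0.
have [mI mg swap] := @tonelli_restrict _ _ _ P `]0%R, +oo[%classic G (measurable_itv _) mG G0.
have Gg x : 0 < x -> (\int[P]_w (G (w, x))%:E = ((theta + x) * g x)%:E)%E.
  move=> x0; rewrite EFinM -Vg// -ge0_integralZl//.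
  - by apply: eq_integral => w _; rewrite /G/= gtr0_norm// EFinM.
  - apply/measurable_EFinP; apply: measurable_funM => //; apply: measurableT_comp => //.
    by apply: measurableT_comp => //; exact: measurable_funM.
  - by move=> w _; rewrite lee_fin mulr_ge0 ?expR_ge0.
  - by rewrite lee_fin ltW// addr_gt0.
split.
  apply: eq_measurable_fun mg => x; rewrite inE/= in_itv/= andbT => x0.
  exact: Gg.
transitivity (\int[P]_w \int[mu]_(x in `]0%R, +oo[) (G (w, x))%:E)%E.
  apply: ge0_ae_eq_integral => //.
  - apply/measurable_EFinP; apply: measurable_funM => //.
    exact: measurable_fun_inv_ge0.
  - by move=> w _; rewrite lee_fin divr_ge0.
  - by move=> w _; apply: integral_ge0 => x _; rewrite lee_fin.
  - apply: filterS energy_pos => w Sw _.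
    transitivity (\int[mu]_(x in `]0%R, +oo[) ((V w)%:E *
        ((theta + x) * expR (- (rate x * S w)))%:E))%E; last first.
      apply: eq_integral => x; rewrite inE/= in_itv/= andbT => x0.
      by rewrite /G/= gtr0_norm// -EFinM; congr (_%:E); ring.
    have mf : measurable_fun setT (fun x : R => (theta + x) * expR (- (rate x * S w))).
      apply: measurable_funM; first exact: measurable_funD.
      apply: measurableT_comp => //; apply: measurableT_comp => //.
      apply: measurable_funM => //; apply: measurable_funM => //.
      by apply: measurable_funD => //; exact: measurable_funM.
    rewrite ge0_integralZl//; last 3 first.
    - by apply/measurable_EFinP; exact: measurable_funTS.
    - move=> x; rewrite /= in_itv/= andbT => x0.
      by rewrite lee_fin mulr_ge0 ?expR_ge0// addr_ge0 ?ltW.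
    - by rewrite lee_fin.
    rewrite integral_itv_obnd_cbnd; last first.
      by apply/measurable_EFinP; exact: measurable_funTS.
    by rewrite integral_inverse.
rewrite swap; apply: eq_integral => x; rewrite inE/= in_itv/= andbT => x0.
exact: Gg.
Qed.

(** This is minus the derivative of the joint Laplace transform in m at 0. The
    difference quotients (1 - exp (- m Q)) / m increase as m runs through
    2^-k, so that the limit can be taken under the expectation by monotone
    convergence. *)
Lemma terminal_laplace x : 0 < x ->
  (\int[P]_w (Q w * expR (- (rate x * S w)))%:E =
   (riccati_slope theta x L / (2 * Num.sqrt (riccati_lim theta x 0 L) ^+ 3))%:E)%E.
Proof.
move=> x0.
pose m k : R := 2 ^- k.
have m0 k : 0 < m k by rewrite invr_gt0 exprn_gt0.
have mS' k : m k = m k.+1 *+ 2 by rewrite /m exprS mulr2n; field; rewrite expf_neq0.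
have cm : m k @[k --> \oo] --> 0.
  have -> : m = (fun k => (2^-1) ^+ k) by apply/funext => k; rewrite /m exprVn.
  by apply: cvg_expr; rewrite ger0_norm ?invf_lt1 ?ltr1n.
pose f k w := (1 - expR (- (m k * Q w))) / m k * expR (- (rate x * S w)).
have mf k : measurable_fun setT (f k).
  apply: measurable_funM.
    apply: measurable_funM => //; apply: measurable_funB => //.
    apply: measurableT_comp => //; apply: measurableT_comp => //.
    exact: measurable_funM.
  apply: measurableT_comp => //; apply: measurableT_comp => //.
  exact: measurable_funM.
have f0 k w : 0 <= f k w.
  rewrite mulr_ge0 ?expR_ge0// divr_ge0 ?(ltW (m0 k))// subr_ge0.
  by rewrite -expR0 ler_expR oppr_le0 mulr_ge0// ltW.
have ndf w : nondecreasing_seq (f ^~ w).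
  apply/nondecreasing_seqP => k; rewrite /f ler_wpM2r ?expR_ge0//.
  rewrite ler_pdivrMr// mulrAC mS'.
  have -> : expR (- (m k.+1 *+ 2 * Q w)) = expR (- (m k.+1 * Q w)) ^+ 2.
    by rewrite -expRM_natl; congr expR; rewrite mulr2n; ring.
  set b := expR _.
  have -> : (1 - b) * (m k.+1 *+ 2) / m k.+1 = 2 * (1 - b).
    by rewrite mulr2n; field; rewrite gt_eqF.
  have b1 : b <= 1 by rewrite -expR0 ler_expR oppr_le0 mulr_ge0// ltW.
  have b0 : 0 < b by exact: expR_gt0.
  have -> : 1 - b ^+ 2 = (1 + b) * (1 - b) by ring.
  by rewrite ler_wpM2r ?subr_ge0// -natr1 [leRHS]addrC lerD2l.
have limf w : f k w @[k --> \oo] --> Q w * expR (- (rate x * S w)).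
  apply: cvgM; last exact: cvg_cst.
  under eq_cvg do rewrite [m _ * _]mulrC.
  exact: one_sub_expR_slope_cvg.
have E1 k : (\int[P]_w (f k w)%:E = (((Num.sqrt (riccati_lim theta x 0 L))^-1 -
    (Num.sqrt (riccati_lim theta x (m k) L))^-1) / m k)%:E)%E.
  pose e2 w := expR (- (x * (theta + x / 2) * S w + m k * Q w)).
  have me2 : measurable_fun setT e2.
    apply: measurableT_comp => //; apply: measurableT_comp => //.
    by apply: measurable_funD; exact: measurable_funM.
  have me1 : measurable_fun setT (fun w => expR (- (rate x * S w))).
    apply: measurableT_comp => //; apply: measurableT_comp => //.
    exact: measurable_funM.
  have E : (\int[P]_w (f k w)%:E + \int[P]_w ((m k)^-1%:E * (e2 w)%:E) =
      \int[P]_w ((m k)^-1%:E * (expR (- (rate x * S w)))%:E))%E.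
  { rewrite -ge0_integralD//=.
    - apply: eq_integral => w _; rewrite -!EFinM -EFinD; congr (_%:E).
      by rewrite /f /e2 opprD expRD; field; rewrite gt_eqF.
    all: try by apply/measurable_EFinP; try exact: measurable_funM.
    all: by move=> w _; rewrite ?lee_fin// mulr_ge0 ?expR_ge0// invr_ge0 ltW. }
  have mi0 : (0 <= (m k)^-1%:E)%E by rewrite lee_fin invr_ge0 ltW.
  have mE1 := (measurable_EFinP _ _).2 me1.
  have mE2 := (measurable_EFinP _ _).2 me2.
  have e20 w : setT w -> (0 <= (e2 w)%:E)%E by rewrite lee_fin expR_ge0.
  move: E; rewrite !ge0_integralZl//.
  rewrite laplace ?(ltW (m0 k))// laplace_energy// -!EFinM => E.
  by rewrite mulrBl ![_ / m k]mulrC EFinB -E addeK.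
pose A mk := riccati_lim theta x mk L.
have A0 mk : 0 <= mk -> 0 < A mk by move=> ?; exact: riccati_lim_gt0.
have AE mk : A mk = A 0 + mk * riccati_slope theta x L.
  by rewrite /A /riccati_slope /riccati_lim; field; rewrite gt_eqF// addr_gt0.
have lim1 : (\int[P]_w (f k w)%:E)%E @[k --> \oo] -->
    (riccati_slope theta x L / (2 * Num.sqrt (A 0) ^+ 3))%:E.
  suff cR : ((Num.sqrt (A 0))^-1 - (Num.sqrt (A (m k)))^-1) / m k @[k --> \oo] -->
      riccati_slope theta x L / (2 * Num.sqrt (A 0) ^+ 3).
    under eq_cvg do rewrite E1.
    by apply: cvg_EFin; [exact: nearW|exact: cR].
  have -> : (fun k => ((Num.sqrt (A 0))^-1 - (Num.sqrt (A (m k)))^-1) / m k) =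
    (fun k => riccati_slope theta x L * (Num.sqrt (A 0) * Num.sqrt (A (m k)) *
      (Num.sqrt (A 0) + Num.sqrt (A (m k))))^-1).
    apply/funext => k; have mk0 := ltW (m0 k).
    have sA0 : 0 < Num.sqrt (A 0) by rewrite sqrtr_gt0 A0.
    have sAk : 0 < Num.sqrt (A (m k)) by rewrite sqrtr_gt0 A0.
    (* A (m k) - A 0 is factored as a difference of squares of square roots. *)
    have slopeE : riccati_slope theta x L =
        (Num.sqrt (A (m k)) ^+ 2 - Num.sqrt (A 0) ^+ 2) / m k.
      rewrite !sqr_sqrtr ?ltW ?A0// AE; field.
      by rewrite gt_eqF.
    by rewrite slopeE; field; rewrite !gt_eqF// addr_gt0.
  have cA : Num.sqrt (A (m k)) @[k --> \oo] --> Num.sqrt (A 0).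
    have cA0 : A (m k) @[k --> \oo] --> A 0.
      have -> : (fun k => A (m k)) = (fun k => A 0 + m k * riccati_slope theta x L).
        by apply/funext => k; rewrite AE.
      rewrite -[X in _ --> X]addr0 -(mul0r (riccati_slope theta x L)).
      by apply: cvgD; [exact: cvg_cst|apply: cvgM => //; exact: cvg_cst].
    by apply: (cvg_comp _ Num.sqrt); [exact: cA0|exact: sqrt_continuous].
  have sA0 : 0 < Num.sqrt (A 0) by rewrite sqrtr_gt0 A0.
  have -> : 2 * Num.sqrt (A 0) ^+ 3 =
      Num.sqrt (A 0) * Num.sqrt (A 0) * (Num.sqrt (A 0) + Num.sqrt (A 0)) by ring.
  apply: cvgM; first exact: cvg_cst.
  apply: cvgV; first by rewrite gt_eqF// !mulr_gt0// addr_gt0.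
  apply: cvgM; last by apply: cvgD => //; exact: cvg_cst.
  by apply: cvgM => //; exact: cvg_cst.
have lim2 : (\int[P]_w (f k w)%:E)%E @[k --> \oo] -->
    (\int[P]_w (Q w * expR (- (rate x * S w)))%:E)%E.
  have -> : (\int[P]_w (Q w * expR (- (rate x * S w)))%:E =
      \int[P]_w limn (fun k => (f k w)%:E))%E.
    apply: eq_integral => w _; apply/esym/cvg_lim => //.
    by apply: cvg_EFin; [exact: nearW|exact: limf].
  apply: (@cvg_monotone_convergence _ _ _ P setT measurableT
    (fun k w => (f k w)%:E)).
  - by move=> k; exact/measurable_EFinP.
  - by move=> k w _; rewrite lee_fin.
  - by move=> w _ k l kl; rewrite lee_fin; exact: ndf.
exact: (cvg_unique _ lim2 lim1).
Qed.

End inverse_moments.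

(** * Bounds on the moments *)

Section moment_bounds.
Context d (T : measurableType d) (R : realType) (P : probability T R).
Notation mu := (@lebesgue_measure R).
Variables (S Q : T -> R) (theta L : R).
Hypotheses (mS : measurable_fun setT S) (mQ : measurable_fun setT Q).
Hypotheses (S0 : forall w, 0 <= S w) (Q0 : forall w, 0 <= Q w).
Hypotheses (theta0 : 0 < theta) (L0 : 0 < L).
Hypothesis laplace : forall x m : R, 0 < x -> 0 <= m ->
  (\int[P]_w (expR (- (x * (theta + x / 2) * S w + m * Q w)))%:E =
   ((Num.sqrt (riccati_lim theta x m L))^-1)%:E)%E.

Let a := L / 2.
Let eps := expR (- (2 * theta * L)).

Let a0 : 0 < a. Proof. by rewrite divr_gt0. Qed.

Let eps1 : eps <= 1.
Proof. by rewrite -expR0 ler_expR oppr_le0 !mulr_ge0 ?ltW. Qed.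

Lemma integral_poly_expR_open (c0 c1 c2 : R) :
  0 <= c0 -> 0 <= c1 -> 0 <= c2 ->
  (\int[mu]_(x in `]0%R, +oo[) ((c0 + c1 * x + c2 * x ^+ 2) * expR (- (a * x)))%:E
   = (c0 / a + c1 / a ^+ 2 + 2 * c2 / a ^+ 3)%:E)%E.
Proof.
move=> c00 c10 c20; rewrite -integral_poly_expR// integral_itv_obnd_cbnd//.
apply/measurable_EFinP; apply: measurable_funTS; apply: measurable_funM.
  apply: measurable_funD; first by apply: measurable_funD => //; exact: measurable_funM.
  by apply: measurable_funM => //; exact: measurable_funX.
by apply: measurableT_comp => //; apply: measurableT_comp => //; exact: measurable_funM.
Qed.

Lemma integral_density_bounds (f : R -> R) (b0 b1 c0 c1 c2 : R) :
  0 <= b0 -> 0 <= b1 -> 0 <= c0 -> 0 <= c1 -> 0 <= c2 ->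
  (forall x, 0 < x -> (b0 + b1 * x) * expR (- (a * x)) <= f x <=
     (c0 + c1 * x + c2 * x ^+ 2) * expR (- (a * x))) ->
  measurable_fun (`]0, +oo[%classic : set R) (EFin \o f) ->
  ((b0 / a + b1 / a ^+ 2)%:E <= \int[mu]_(x in `]0%R, +oo[) (f x)%:E <=
   (c0 / a + c1 / a ^+ 2 + 2 * c2 / a ^+ 3)%:E)%E.
Proof.
move=> b00 b10 c00 c10 c20 fb mf.
have f0 x : 0 < x -> 0 <= f x.
  move=> x0; have /andP[lo _] := fb _ x0.
  by rewrite (le_trans _ lo)// mulr_ge0 ?expR_ge0// addr_ge0// mulr_ge0// ltW.
have mpoly (k0 k1 k2 : R) : measurable_fun (`]0, +oo[%classic : set R)
    (EFin \o (fun x => (k0 + k1 * x + k2 * x ^+ 2) * expR (- (a * x)))).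
  apply/measurable_EFinP; apply: measurable_funTS; apply: measurable_funM.
    apply: measurable_funD; first by apply: measurable_funD => //; exact: measurable_funM.
    by apply: measurable_funM => //; exact: measurable_funX.
  by apply: measurableT_comp => //; apply: measurableT_comp => //; exact: measurable_funM.
rewrite -integral_poly_expR_open//.
rewrite [X in (X%:E <= _ <= _)%E](_ : _ = b0 / a + b1 / a ^+ 2 + 2 * 0 / a ^+ 3); last first.
  by rewrite mulr0 mul0r addr0.
rewrite -integral_poly_expR_open//; apply/andP; split; apply: ge0_le_integral => //.
- move=> x; rewrite /= in_itv/= andbT => x0.
  by rewrite lee_fin mul0r addr0 mulr_ge0 ?expR_ge0// addr_ge0// mulr_ge0// ltW.
- exact: (mpoly b0 b1 0).
- move=> x; rewrite /= in_itv/= andbT => x0.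
  by rewrite lee_fin mul0r addr0; have /andP[] := fb _ x0.
- by move=> x; rewrite /= in_itv/= andbT => x0; rewrite lee_fin f0.
- exact: (mpoly c0 c1 c2).
- move=> x; rewrite /= in_itv/= andbT => x0.
  by rewrite lee_fin; have /andP[] := fb _ x0.
Qed.

Lemma inverse_energy_bounds :
  ((theta / a + (5 - eps) / 4 / a ^+ 2)%:E <= \int[P]_w (1 / S w)%:E <=
   (theta / a + 5 / 4 / a ^+ 2 + 2 * (4 * theta)^-1 / a ^+ 3)%:E)%E.
Proof.
have [mg ->] := @integral_ratio _ _ _ P S Q theta L mS S0 theta0 L0 laplace (fun=> 1)
  (fun x => (Num.sqrt (riccati_lim theta x 0 L))^-1) (measurable_cst _)
  (fun=> ler01) (fun x x0 => etrans (eq_integral _ _ (fun w _ => congr1 EFin (mul1r _)))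
     (laplace_energy laplace x0)).
apply: integral_density_bounds mg => //.
- exact: ltW.
- by rewrite divr_ge0// subr_ge0 (le_trans eps1)// ler1n.
- exact: ltW.
- by rewrite invr_ge0 mulr_ge0// ltW.
- by move=> x x0; exact: energy_density_bounds.
Qed.

Lemma terminal_ratio_bounds :
  ((2^-1 * (1 - eps) / a)%:E <= \int[P]_w (Q w / S w)%:E <=
   (2^-1 / a + 3 / (2 * theta) / a ^+ 2)%:E)%E.
Proof.
have [mg ->] := @integral_ratio _ _ _ P S Q theta L mS S0 theta0 L0 laplace Q
  (fun x => riccati_slope theta x L / (2 * Num.sqrt (riccati_lim theta x 0 L) ^+ 3)) mQ
  Q0 (fun x x0 => terminal_laplace mS mQ Q0 theta0 L0 laplace x0).
have := @integral_density_bounds _ (2^-1 * (1 - eps)) 0 2^-1 (3 / (2 * theta)) 0 _ _ _ _ _ _ mg.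
rewrite mul0r mulr0 mul0r !addr0; apply => //.
- by rewrite mulr_ge0// subr_ge0.
- by rewrite divr_ge0// mulr_ge0// ltW.
- move=> x x0; rewrite !mul0r !addr0.
  exact: terminal_density_bounds.
Qed.

End moment_bounds.

(** * Bias of the estimator *)

Lemma integral_affine2 d (T : measurableType d) (R : realType)
    (P : probability T R) (f g : T -> R) (c k l r1 r2 : R) :
  measurable_fun setT f -> measurable_fun setT g ->
  (forall w, 0 <= f w) -> (forall w, 0 <= g w) ->
  (\int[P]_w (f w)%:E = r1%:E)%E -> (\int[P]_w (g w)%:E = r2%:E)%E ->
  (\int[P]_w (c + k * f w - l * g w)%:E = (c + k * r1 - l * r2)%:E)%E.
Proof.
move=> mf mg f0 g0 fE gE.
have intf (u : T -> R) r : measurable_fun setT u -> (forall w, 0 <= u w) ->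
    (\int[P]_w (u w)%:E = r%:E)%E -> P.-integrable setT (EFin \o u).
  move=> mu u0 uE; apply/integrableP; split; first exact/measurable_EFinP.
  under eq_integral do rewrite /= ger0_norm//.
  by rewrite uE ltry.
have If := intf _ _ mf f0 fE; have Ig := intf _ _ mg g0 gE.
have Ikf : P.-integrable setT (EFin \o (fun w => k * f w)).
  exact: (integrableZl measurableT k If).
have Ilg : P.-integrable setT (EFin \o (fun w => l * g w)).
  exact: (integrableZl measurableT l Ig).
have Ic : P.-integrable setT (EFin \o (fun=> c)).
  exact: finite_measure_integrable_cst.
have Ickf : P.-integrable setT (EFin \o (fun w => c + k * f w)).
  exact: (integrableD measurableT Ic Ikf).
have EZ (u : T -> R) j r : P.-integrable setT (EFin \o u) ->
    (\int[P]_w (u w)%:E = r%:E)%E -> (\int[P]_w (j * u w)%:E = (j * r)%:E)%E.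
  move=> Iu uE; under eq_integral do rewrite EFinM.
  by rewrite integralZl// uE.
rewrite integralB_EFin// integralD_EFin// (EZ _ _ _ If fE) (EZ _ _ _ Ig gE).
by rewrite integral_cst// [X in (_ * X)%E](probability_setT P) mule1.
Qed.

(** The bounds on E[1 / S] and E[Q / S] have the same leading terms on both
    sides: theta + 5 / (2 L) for (L / 2) E[1 / S], and 1 / L for E[Q / S]. *)
Lemma mle_bias_bound d (Omega : measurableType d) (R : realType)
    (P : probability Omega R) (W X : R -> {RV P >-> R}) (alpha L T : R)
    (alphahat : {RV P >-> R}) :
  brownian_motion W -> 2^-1 < alpha -> alpha_brownian_bridge W alpha X ->
  0 < L -> T = 1 - expR (- L) -> is_alpha_mle T X alphahat ->
  exists2 r, ('E_P[alphahat] - alpha%:E = r%:E)%E &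
    `|r - 2 / L| <= 4 / L ^+ 2 / (alpha - 2^-1).
Proof.
move=> hW alpha2 hX L0 TE [I hI hhat].
have alpha0 : 0 <= alpha by lra.
pose theta := alpha - 2^-1.
have theta0 : 0 < theta by rewrite subr_gt0.
pose S := energy W alpha L; pose Q := terminal X T.
have mS : measurable_fun setT S by exact: energy_measurable.
have mQ : measurable_fun setT Q by exact: terminal_measurable.
have S0 w : 0 <= S w by exact: energy_ge0.
have Q0 w : 0 <= Q w by exact: (terminal_ge0 X TE).
have lap (x m : R) : 0 < x -> 0 <= m -> 
  (\int[P]_w (expR (- (x * (theta + x / 2) * S w + m * Q w)))%:E =
   ((Num.sqrt (riccati_lim theta x m L))^-1)%:E)%E.
  by move=> x0 m0; exact: (bridge_laplace hW alpha0 hX L0 TE).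
have mSV : measurable_fun setT (fun w => 1 / S w).
  by apply: measurable_funM => //; exact: measurable_fun_inv_ge0.
have mQV : measurable_fun setT (fun w => Q w / S w).
  rewrite (_ : (fun w => Q w / S w) = (fun w => Q w * (1 / S w))); last first.
    by apply/funext => w; rewrite mul1r.
  exact: measurable_funM.
have /andP[lo1 hi1] := inverse_energy_bounds mS S0 theta0 L0 lap.
have /andP[lo2 hi2] := terminal_ratio_bounds mS mQ S0 Q0 theta0 L0 lap.
set J1 := (\int[P]_w (1 / S w)%:E)%E in lo1 hi1.
set J2 := (\int[P]_w (Q w / S w)%:E)%E in lo2 hi2.
have [r1 J1E] : exists r1, J1 = r1%:E.
  by move: lo1 hi1; case: J1 => // r _ _; exists r.
have [r2 J2E] : exists r2, J2 = r2%:E.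
  by move: lo2 hi2; case: J2 => // r _ _; exists r.
move: lo1 hi1 lo2 hi2; rewrite J1E J2E !lee_fin => lo1 hi1 lo2 hi2.
have Eh : ('E_P[alphahat] = (2^-1 + L / 2 * r1 - 2^-1 * r2)%:E)%E.
  rewrite unlock -(integral_affine2 2^-1 (L / 2) 2^-1 mSV mQV _ _ J1E J2E); last 2 first.
  - by move=> w; rewrite divr_ge0.
  - by move=> w; rewrite divr_ge0.
  apply: ae_eq_integral => //.
  - exact/measurable_EFinP.
  - apply/measurable_EFinP; apply: measurable_funB; last exact: measurable_funM.
    by apply: measurable_funD => //; exact: measurable_funM.
  - have Iv := ito_integral_value hW alpha0 hX L0 TE hI.
    have Sp := energy_pos mS S0 theta0 L0 lap.
    have lims := bridge_path_limits alpha0 hX L0 TE.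
    near=> w => _; congr (_%:E).
    have -> : alphahat w = - I w / S w.
      have <- : \int[lebesgue_measure]_(s in `[0, T])
          (X s w ^+ 2 / (1 - s) ^+ 2) = S w.
        by near: w; apply: filterS lims => w [].
      by near: w.
    have -> : I w = 2^-1 * (Q w - S w - L) by near: w.
    have Sw : 0 < S w by near: w.
    by field; rewrite gt_eqF.
exists (2^-1 + L / 2 * r1 - 2^-1 * r2 - alpha); first by rewrite Eh EFinB.
set eps := expR _ in lo1 lo2.
have epsle : eps <= (2 * theta * L)^-1.
  rewrite /eps expRN lef_pV2 ?posrE ?expR_gt0 ?mulr_gt0//.
  by rewrite (le_trans _ (expR_ge1Dx _))// lerDr.
have nL : L != 0 by rewrite gt_eqF.
have nt : theta != 0 by rewrite gt_eqF.
(* The bounds are affine in eps * p and p ^ 2 * q, with p = 2 / L and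
   q = theta^-1. *)
pose p := 2 / L; pose q := theta^-1.
have p0 : 0 < p by rewrite divr_gt0.
have pq0 : 0 <= p ^+ 2 * q by rewrite mulr_ge0 ?sqr_ge0// invr_ge0 ltW.
have ep : eps * p <= p ^+ 2 * q / 4.
  apply: (le_trans (ler_wpM2r (ltW p0) epsle)).
  by rewrite le_eqVlt; apply/orP; left; apply/eqP; rewrite /p /q; field; rewrite ?nL ?nt.
have a0 : 0 < L / 2 by rewrite divr_gt0.
have {}lo1 : theta + 5 / 4 * p - (eps * p) / 4 <= L / 2 * r1.
  apply: le_trans (ler_wpM2l (ltW a0) lo1).
  by rewrite le_eqVlt; apply/orP; left; apply/eqP; rewrite /p; field; rewrite ?nL.
have {}hi1 : L / 2 * r1 <= theta + 5 / 4 * p + p ^+ 2 * q / 2.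
  apply: (le_trans (ler_wpM2l (ltW a0) hi1)).
  by rewrite le_eqVlt; apply/orP; left; apply/eqP; rewrite /p /q; field; rewrite ?nL ?nt.
have {}lo2 : 2^-1 * p - (eps * p) / 2 <= r2.
  apply: le_trans lo2.
  by rewrite le_eqVlt; apply/orP; left; apply/eqP; rewrite /p; field; rewrite ?nL.
have {}hi2 : r2 <= 2^-1 * p + 3 / 2 * (p ^+ 2 * q).
  apply: (le_trans hi2).
  by rewrite le_eqVlt; apply/orP; left; apply/eqP; rewrite /p /q; field; rewrite ?nL ?nt.
have -> : 4 / L ^+ 2 / theta = p ^+ 2 * q by rewrite /p /q; field; rewrite ?nL ?nt.
have alphaE : alpha = theta + 2^-1 by rewrite /theta subrK.
rewrite -/p alphaE ler_norml; apply/andP; split; lra.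
Unshelve. all: by end_near. Qed.

Theorem proposition2 (R : realType) (d : measure_display)
  (Omega : measurableType d) (P : probability Omega R)
  (W : R -> {RV P >-> R}) (hW : brownian_motion W)
  (X : R -> R -> {RV P >-> R})
  (hX : forall alpha : R, 0 <= alpha -> alpha_brownian_bridge W alpha (X alpha))
  (T : R) (hT0 : 0 < T) (hT1 : T < 1)
  (alphahat : R -> {RV P >-> R})
  (hmle : forall alpha : R, 0 <= alpha ->
            is_alpha_mle T (X alpha) (alphahat alpha)) :
  ('E_P[alphahat alpha] - alpha%:E)%E @[alpha --> +oo] -->
    (- (2 / ln (1 - T)))%:E.
Proof.
pose L := - ln (1 - T).
have L0 : 0 < L by rewrite oppr_gt0 ln_lt0// subr_gt0 hT1/= ltrBlDr ltrDl.
have TE : T = 1 - expR (- L) by rewrite opprK lnK ?posrE ?subr_gt0// subKr.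
have -> : - (2 / ln (1 - T)) = 2 / L by rewrite /L invrN mulrN.
have bound alpha : 2^-1 < alpha ->
    exists2 r, ('E_P[alphahat alpha] - alpha%:E = r%:E)%E &
      `|r - 2 / L| <= 4 / L ^+ 2 / (alpha - 2^-1).
  move=> alpha2; have alpha0 : 0 <= alpha by lra.
  exact: (mle_bias_bound hW alpha2 (hX _ alpha0) L0 TE (hmle _ alpha0)).
apply: cvg_EFin.
  near=> alpha.
  have alpha2 : 2^-1 < alpha by near: alpha; exact: nbhs_pinfty_gt.
  by have [r -> _] := bound alpha alpha2.
apply/cvgrPdist_le => e e0; near=> alpha.
have alpha2 : 2^-1 < alpha by near: alpha; exact: nbhs_pinfty_gt.
have alphae : 2^-1 + 4 / L ^+ 2 / e < alpha by near: alpha; apply: nbhs_pinfty_gt; exact: num_real.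
have [r /= -> rL] := bound alpha alpha2.
rewrite /= distrC (le_trans rL)// ler_pdivrMr ?subr_gt0// [e * _]mulrC -ler_pdivrMr//.
lra.
Unshelve. all: by end_near. Qed.
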